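(* Let $n>2$, let $M_t$ be an isoparametric foliation on $(S^{n-1}(1),g^{\mathrm{st}})$ with $d>2$ principal curvatures, let $F_1,F_2$ be Minkowski norms on $\mathbb{R}^n$ induced by $M_t$, and let $\Phi$ be a Hessian isometry from $F_1$ to $F_2$ which preserves the orientation and fixes the spherical $\xi$-coordinates. Then $\Phi$ is obtained by gluing positive scalar multiplications and compositions between the Legendre transformation of $F_1$ and positive scalar multiplications; precisely, there is a conic open dense subset $C(U)=\mathbb{R}_{>0}U$ of $\mathbb{R}^n\setminus\{0\}$, where $U\subset S^{n-1}(1)$ is a union of some hypersurfaces in the foliation $M_t$, such that on each connected component of $C(U)$, $\Phi$ coincides either with a positive scalar multiplication $x\mapsto cx$, $c>0$, or with the composition of the Legendre transformation of $F_1$ and a positive scalar multiplication. In particular, $\Phi$ satisfies the (d)-property with respect to every orthogonal decomposition $\mathbb{R}^n=\mathbf{V}'+\mathbf{V}''$: for any nonzero $x=x'+x''$ and $\Phi(x)=\overline{x}=\overline{x}'+\overline{x}''$ with $x',\overline{x}'\in\mathbf{V}'$ and $x'',\overline{x}''\in\mathbf{V}''$, we have $g^{F_1}_x(x'',x)=g^{F_2}_{\overline{x}}(\overline{x}'',\overline{x})$.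
   Context: $g^{\mathrm{st}}$ is the standard flat metric of $\mathbb{R}^n$ (also its restriction to submanifolds). An isoparametric function on a Riemannian manifold $(M,g)$ is a smooth $p:M\to\mathbb{R}$, regular almost everywhere, with $g(\mathrm{grad}\,p,\mathrm{grad}\,p)=a\circ p$ and $\Delta p=b\circ p$ for some one-variable functions $a,b$; the family of its non-empty level sets is called an isoparametric foliation. An isoparametric foliation on $(S^{n-1}(1),g^{\mathrm{st}})$ with $d\in\{1,2,3,4,6\}$ principal curvatures is given by the level sets of an isoparametric function $p:S^{n-1}(1)\to[-1,1]$ which is the restriction of a homogeneous polynomial of degree $d$ on $\mathbb{R}^n$ and has $\pm1$ as its only critical values; each $p^{-1}(s)$, $-1<s<1$, is a closed connected hypersurface with exactly $d$ distinct principal curvatures, and $p^{-1}(\pm1)$ are the two focal submanifolds. It is parametrized as $M_t$, $t\in[0,\tfrac{\pi}d]$, so that $\mathrm{dist}_{S^{n-1}(1)}(x,M_0)=t$ for all $x\in M_t$, where $M_0$ and $M_{\pi/d}$ are the focal submanifolds. A geodesic of $(S^{n-1}(1),g^{\mathrm{st}})$ is normal for $M_t$ if it meets each $M_t$ orthogonally. A point $x\in\mathbb{R}^n\setminus(\mathbb{R}_{\ge0}M_0\cup\mathbb{R}_{\ge0}M_{\pi/d})$ has spherical coordinates $(r,t,\xi)\in\mathbb{R}_{>0}\times(0,\tfrac{\pi}{d})\times M_{\pi/2d}$ when $r=|x|$, $x/|x|\in M_t$, and there is a normal geodesic segment connecting $x/|x|$ to $\xi$ without passing through the focal submanifolds.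 A Minkowski norm on $\mathbb{R}^n$ is a continuous function $F:\mathbb{R}^n\to\mathbb{R}_{\ge0}$, positive and smooth on $\mathbb{R}^n\setminus\{0\}$, with $F(\lambda x)=\lambda F(x)$ for all $\lambda\ge0$, and such that the Hessian matrix of $E=\tfrac12F^2$ is positive definite at every $x\neq0$. Its Hessian metric is $g=\mathrm{d}^2E$ on $\mathbb{R}^n\setminus\{0\}$, written $g^F_x(\cdot,\cdot)$ at $x$. $F$ is induced by $M_t$ if it is constant on each $M_t$. A Hessian isometry from $F_1$ to $F_2$ is a diffeomorphism of $\mathbb{R}^n\setminus\{0\}$ which is an isometry from the Hessian metric of $F_1$ to that of $F_2$. It preserves the orientation and fixes the spherical $\xi$-coordinates if it is an orientation preserving diffeomorphism, preserves $\mathbb{R}^n\setminus(\mathbb{R}_{\geq0}M_0\cup\mathbb{R}_{\geq0}M_{\pi/d})$, and for every $x$ in this set $x$ and $\Phi(x)$ have the same $\xi$-coordinate. The Legendre transformation of $F$ is the diffeomorphism of $\mathbb{R}^n\setminus\{0\}$ given in orthonormal coordinates by $(x_1,\dots,x_n)\mapsto(\tfrac{\partial E}{\partial x_1},\dots,\tfrac{\partial E}{\partial x_n})$, $E=\tfrac12F^2$. Conic means invariant under multiplication by positive scalars. *)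

(* Defs.v *)
From HB Require Import structures.
From mathcomp Require Import all_boot all_order all_algebra.
(* The notations of mpoly clash with those of mathcomp-analysis. *)
From mathcomp Require Import(canonicals) mpoly.
From mathcomp Require Import all_classical all_reals all_analysis.

Set Implicit Arguments.
Unset Strict Implicit.
Unset Printing Implicit Defensive.

Import Order.TTheory GRing.Theory Num.Theory.
Import numFieldNormedType.Exports.

Local Open Scope classical_set_scope.
Local Open Scope ring_scope.

Section Smoothness.
Context {R : realType} {V W : normedModType R}.

Fixpoint iter_derive (vs : seq V) (f : V -> W) : V -> W :=
  if vs is v :: vs' then 'D_v (iter_derive vs' f) else f.

(** Meant for an open set [A], on which it says C^oo: all iterated directional
    derivatives exist and are continuous at the points of [A]. *)
Definition smooth_on (A : set V) (f : V -> W) : Prop :=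
  forall (vs : seq V) (x : V), A x ->
    {for x, continuous (iter_derive vs f)} /\
    forall v : V, derivable (iter_derive vs f) x v.

End Smoothness.

Section Euclidean.
Context {R : realType} {n : nat}.
Implicit Types (x y u v w : 'rV[R]_n) (A : set 'rV[R]_n).

(** The library norm on ['rV[R]_n] is the sup norm; it induces the same
    topology, but lengths and angles are those of [dot]. *)
Definition dot u v : R := (u *m v^T) 0 0.
Definition enorm u : R := Num.sqrt (dot u u).
Definition normalize u : 'rV[R]_n := (enorm u)^-1 *: u.

Definition usphere : set 'rV[R]_n := [set x | enorm x = 1].
Definition punctured : set 'rV[R]_n := [set x | x != 0].

Definition grad (f : 'rV[R]_n -> R) x : 'rV[R]_n :=
  \row_i 'D_(delta_mx 0 i) f x.

(** Calculus on the unit sphere.  A function on the sphere is represented by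
    a function on the ambient space, of which only the values on [usphere]
    are used.  Its extension that is constant on open rays has, at points of
    the sphere, a vanishing radial derivative, and in polar coordinates the
    flat Laplacian is d^2/dr^2 + (n-1)/r d/dr + r^-2 (spherical Laplacian).
    Hence at points of the sphere the flat gradient and the flat Laplacian
    of that extension are the Riemannian ones of the round metric. *)
Definition radial_ext (f : 'rV[R]_n -> R) : 'rV[R]_n -> R := f \o normalize.

Definition smooth_on_sphere (f : 'rV[R]_n -> R) : Prop :=
  smooth_on punctured (radial_ext f).

Definition sgrad (f : 'rV[R]_n -> R) x : 'rV[R]_n := grad (radial_ext f) x.

Definition slaplacian (f : 'rV[R]_n -> R) x : R :=
  \sum_(i < n)
    'D_(delta_mx 0 i) ('D_(delta_mx 0 i) (radial_ext f)) x.

Definition sphere_dist x A : R := inf [set acos (dot x y) | y in A].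

(** (n-1)-dimensional null sets (the library balls are cubes). *)
Definition sphere_null A : Prop :=
  forall e : R, 0 < e ->
  exists (c : nat -> 'rV[R]_n) (r : nat -> R),
    [/\ forall k, 0 <= r k,
        A `<=` \bigcup_k ball (c k) (r k) &
        (\sum_(k <oo) (r k ^+ n.-1)%:E < e%:E)%E].

Definition tangent_vector A x w : Prop :=
  exists c : R -> 'rV[R]_n,
    [/\ c 0 = x, \forall s \near (0 : R), A (c s) & is_derive (0 : R) 1 c w].

(** Unit speed geodesics of the sphere: the Levi-Civita covariant derivative
    of the velocity is the tangential part of the acceleration. *)
Definition sphere_geodesic (g : R -> 'rV[R]_n) : Prop :=
  smooth_on setT g /\
  forall s : R,
    [/\ usphere (g s), enorm (derive1 g s) = 1 &
        forall v, dot v (g s) = 0 -> dot v (derive1 (derive1 g) s) = 0].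

End Euclidean.

Section Isoparametric.
Context {R : realType} {n : nat}.
Implicit Types (x w xi : 'rV[R]_n) (p : 'rV[R]_n -> R).

Definition level_set p (s : R) : set 'rV[R]_n :=
  [set x | usphere x /\ p x = s].

Record isoparametric_function p : Prop := IsoparametricFunction {
  isop_smooth : smooth_on_sphere p;
  isop_regular : sphere_null [set x | usphere x /\ sgrad p x = 0];
  isop_gradient : exists a : R -> R,
    forall x, usphere x -> dot (sgrad p x) (sgrad p x) = a (p x);
  isop_laplacian : exists b : R -> R,
    forall x, usphere x -> slaplacian p x = b (p x) }.

Definition critical_value p (s : R) : Prop :=
  exists x, [/\ usphere x, p x = s & sgrad p x = 0].

Definition unit_normal p x : 'rV[R]_n := normalize (sgrad p x).

(** Eigenvalues of the shape operator [w |-> - D_w nu] at [x] of the level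
    hypersurface of [p] through [x] in the sphere; the condition on [w] is
    tangency to that hypersurface.  The ambient derivative of the unit normal
    field [nu] along such [w] is orthogonal to [x] and to [nu], so that no
    projection is needed. *)
Definition principal_curvature p x (l : R) : Prop :=
  exists w, [/\ w != 0, dot w x = 0, dot w (unit_normal p x) = 0 &
    'D_w (unit_normal p) x = - l *: w].

Record isoparametric_polynomial (d : nat) p : Prop := IsoparametricPolynomial {
  isopol_isop : isoparametric_function p;
  isopol_range : forall x, usphere x -> -1 <= p x <= 1;
  isopol_homog : exists P : mpoly.mpoly n R,
    P \is mpoly.ishomog1 d (mpoly.Measure.clone n mpoly.mdeg _) /\
    forall x, usphere x -> p x = mpoly.meval (fun i => x 0 i) P;
  isopol_critical : forall s : R, critical_value p s <-> s = 1 \/ s = -1;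
  isopol_connected : forall s : R, -1 < s < 1 -> connected (level_set p s);
  isopol_curvatures : forall x, usphere x -> -1 < p x < 1 ->
    exists ls : seq R, [/\ uniq ls, size ls = d &
      forall l : R, principal_curvature p x l <-> l \in ls] }.

Definition param_interval (d : nat) : set R := [set t | 0 <= t <= pi / d%:R].

(** Only the values [M t], [t \in [0, pi / d]], are constrained and used. *)
Record isoparametric_foliation (d : nat) (M : R -> set 'rV[R]_n) : Prop :=
  IsoparametricFoliation {
    isofol_deg : d \in [:: 1; 2; 3; 4; 6]%N;
    isofol_levels : exists p,
      [/\ isoparametric_polynomial d p,
          (forall t, param_interval d t ->
             exists s : R, -1 <= s <= 1 /\ M t = level_set p s),
          (forall s : R, -1 <= s <= 1 ->
             exists t, param_interval d t /\ M t = level_set p s) &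
          (M 0 = level_set p 1 /\ M (pi / d%:R) = level_set p (-1)) \/
          (M 0 = level_set p (-1) /\ M (pi / d%:R) = level_set p 1)];
    isofol_dist : forall t, param_interval d t ->
      forall x, M t x -> sphere_dist x (M 0) = t }.

Variables (d : nat) (M : R -> set 'rV[R]_n).

Definition focal : set 'rV[R]_n := M 0 `|` M (pi / d%:R).

Definition regular_points : set 'rV[R]_n :=
  ~` [set x | exists (l : R) y, [/\ 0 <= l, focal y & x = l *: y]].

Definition normal_geodesic (g : R -> 'rV[R]_n) : Prop :=
  sphere_geodesic g /\
  forall s t : R, param_interval d t -> M t (g s) ->
    forall w, tangent_vector (M t) (g s) w -> dot w (derive1 g s) = 0.

Definition spherical_coords x (r t : R) xi : Prop :=
  [/\ regular_points x, 0 < r /\ r = enorm x,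
      0 < t < pi / d%:R /\ M t (normalize x),
      M (pi / (2 * d%:R)) xi &
      exists (g : R -> 'rV[R]_n) (a b : R),
        [/\ normal_geodesic g, a <= b, g a = normalize x, g b = xi &
            forall s, a <= s <= b -> ~ focal (g s)]].

Definition induced_by (F : 'rV[R]_n -> R) : Prop :=
  forall t, param_interval d t ->
    forall x y, M t x -> M t y -> F x = F y.

Definition preserves_orientation (Phi : 'rV[R]_n -> 'rV[R]_n) : Prop :=
  forall x, x != 0 -> 0 < \det (jacobian Phi x).

Definition fixes_xi (Phi : 'rV[R]_n -> 'rV[R]_n) : Prop :=
  Phi @` regular_points = regular_points /\
  forall x, regular_points x -> exists xi (r t r' t' : R),
    spherical_coords x r t xi /\ spherical_coords (Phi x) r' t' xi.

End Isoparametric.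

Section Minkowski.
Context {R : realType} {n : nat}.
Implicit Types (F : 'rV[R]_n -> R) (Phi : 'rV[R]_n -> 'rV[R]_n).

Definition energy F (x : 'rV[R]_n) : R := F x ^+ 2 / 2.

Definition hessian_metric F (x u v : 'rV[R]_n) : R :=
  'D_u ('D_v (energy F)) x.

Record minkowski_norm F : Prop := MinkowskiNorm {
  mink_continuous : continuous F;
  mink_ge0 : forall x, 0 <= F x;
  mink_gt0 : forall x, x != 0 -> 0 < F x;
  mink_smooth : smooth_on punctured F;
  mink_homog : forall (l : R) x, 0 <= l -> F (l *: x) = l * F x;
  mink_hessian : forall x v, x != 0 -> v != 0 -> 0 < hessian_metric F x v v }.

Definition punctured_diffeo Phi : Prop :=
  exists Psi : 'rV[R]_n -> 'rV[R]_n,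
    [/\ smooth_on punctured Phi, smooth_on punctured Psi,
        forall x, x != 0 -> Phi x != 0 /\ Psi (Phi x) = x &
        forall y, y != 0 -> Psi y != 0 /\ Phi (Psi y) = y].

Definition hessian_isometry F1 F2 Phi : Prop :=
  punctured_diffeo Phi /\
  forall x u v, x != 0 ->
    hessian_metric F2 (Phi x) ('D_u Phi x) ('D_v Phi x) =
    hessian_metric F1 x u v.

Definition legendre F : 'rV[R]_n -> 'rV[R]_n := grad (energy F).

Definition positive_cone (U : set 'rV[R]_n) : set 'rV[R]_n :=
  [set x | exists (l : R) u, [/\ 0 < l, U u & x = l *: u]].

Definition orthogonal_decomposition (V' V'' : {vspace 'rV[R]_n}) : Prop :=
  (V' + V'')%VS = fullv /\
  forall u v, u \in V' -> v \in V'' -> dot u v = 0.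

Definition d_property F1 F2 Phi (V' V'' : {vspace 'rV[R]_n}) : Prop :=
  forall x x' x'' y' y'' : 'rV[R]_n,
    x != 0 -> x = x' + x'' -> Phi x = y' + y'' ->
    x' \in V' -> y' \in V' -> x'' \in V'' -> y'' \in V'' ->
    hessian_metric F1 x x'' x = hessian_metric F2 (Phi x) y'' (Phi x).

End Minkowski.

(* Main.v *)
Require Import Defs.
From HB Require Import structures.
From mathcomp Require Import all_boot all_order all_algebra.
From mathcomp Require Import(canonicals, coercions) mpoly.
From mathcomp Require Import all_classical all_reals all_analysis.
From mathcomp Require Import ring lra.
Set Implicit Arguments.
Unset Strict Implicit.
Unset Printing Implicit Defensive.
Import Order.TTheory GRing.Theory Num.Theory.
Import numFieldNormedType.Exports.
Local Open Scope classical_set_scope.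
Local Open Scope ring_scope.

(** The proof works in the normal planes.  At a regular point x, that is, off
    the cones over the focal submanifolds, let nu be the unit normal of the
    leaf through x / |x|, extended to be constant along rays, and let the normal
    plane be the span of x and nu x.  Normal geodesics are great circles, so
    this plane is constant along the normal circle through x.  Four vectors
    lie in it: x, dE1(x), Phi(x) (which has the same xi-coordinate as x), and
    dE2(Phi(x)).

    Let w be a principal direction of the leaf at x with D_w nu = - k w.  A
    field a x + b nu in the normal planes has derivative (a - k b) w in the
    direction w, up to a vector of the normal plane.  Normal planes and leaves
    are Hessian orthogonal and dPhi preserves the normal plane, whence dPhi(w)
    is a multiple of w.  The isometry equation on w then reads
      r - k s = (a - k b) (a' - k b'),
    where (r, s), (a, b), (a', b') are the coordinates of dE1(x), Phi(x) and
    dE2(Phi(x)) (curvature_equation).  It holds for the d > 2 principal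
    curvatures, so it is an identity of quadratic polynomials in k, and b b' = 0
    (quadratic_factors).  If b = 0 then Phi(x) = c x and dE2(Phi(x)) = dE1(x) / c;
    if b' = 0 then Phi(x) = c dE1(x) and dE2(Phi(x)) = x / c
    (pointwise_dichotomy).  The constant c is positive because a - k b vanishes
    only at focal points of the normal circle, and x and Phi(x) are joined to
    the same xi by arcs free of such points (same_foot_sign).

    In both cases E2(Phi(x)) = E1(x).  Differentiating this identity where one
    case holds on an open set gives dc = 0 (derive_factor_eq0), so that c is
    constant on connected pieces.  Which case holds depends only on the leaf
    (defect_id_leaf): leaves are connected, and both cases hold at a point only
    if dE1 is radial there, which happens on whole leaves
    (normal_derivative_leaf).  Hence, within the regular points, the interior of
    the set where Phi is radial and the complement of that set are cones over
    unions of leaves.  Their union is dense in the regular points, which are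
    themselves dense (regular_dense).

    For the (d)-property, both cases say that the symmetric products of x with
    dE1(x) and of Phi(x) with dE2(Phi(x)) coincide.  This extends to all nonzero
    x by density (symmetric_product); pairing it with the orthogonal projection
    to the second summand is the (d)-property. *)

(** * The Euclidean inner product *)

Section DotProduct.
Context {R : realType} {n : nat}.
Implicit Types (u v w x y : 'rV[R]_n) (k : R).

Lemma dotE u v : dot u v = \sum_i u 0 i * v 0 i.
Proof. by rewrite /dot mxE; apply: eq_bigr => i _; rewrite mxE. Qed.

Lemma dotC u v : dot u v = dot v u.
Proof. by rewrite !dotE; apply: eq_bigr => i _; rewrite mulrC. Qed.

Lemma dotDl u v w : dot (u + v) w = dot u w + dot v w.
Proof. by rewrite /dot mulmxDl mxE. Qed.

Lemma dotZl k u v : dot (k *: u) v = k * dot u v.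
Proof. by rewrite /dot -scalemxAl mxE. Qed.

Lemma dotDr u v w : dot u (v + w) = dot u v + dot u w.
Proof. by rewrite dotC dotDl dotC [dot w u]dotC. Qed.

Lemma dotZr k u v : dot u (k *: v) = k * dot u v.
Proof. by rewrite dotC dotZl dotC. Qed.

Lemma dotNl u v : dot (- u) v = - dot u v.
Proof. by rewrite -scaleN1r dotZl mulN1r. Qed.

Lemma dotNr u v : dot u (- v) = - dot u v.
Proof. by rewrite dotC dotNl dotC. Qed.

Lemma dot0l u : dot 0 u = 0.
Proof. by rewrite /dot mul0mx mxE. Qed.

Lemma dot0r u : dot u 0 = 0.
Proof. by rewrite dotC dot0l. Qed.

Definition dotlin := (dotDl, dotDr, dotNl, dotNr, dotZl, dotZr, dot0l, dot0r).

Lemma dot_ge0 u : 0 <= dot u u.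
Proof. by rewrite dotE sumr_ge0// => i _; rewrite -expr2 sqr_ge0. Qed.

Lemma dot_eq0 u : (dot u u == 0) = (u == 0).
Proof.
apply/eqP/eqP => [|->]; last by rewrite dot0l.
rewrite dotE => /psumr_eq0P u0; apply/rowP => i; rewrite mxE.
apply/eqP; rewrite -[_ == 0]orbb -mulf_eq0; apply/eqP; apply: u0 => // j _.
by rewrite -expr2 sqr_ge0.
Qed.

Lemma dot_gt0 u : (0 < dot u u) = (u != 0).
Proof. by rewrite lt_def dot_ge0 andbT dot_eq0. Qed.

Lemma enorm_gt0 u : (0 < enorm u) = (u != 0).
Proof. by rewrite /enorm sqrtr_gt0 dot_gt0. Qed.

Lemma enorm_sqr u : enorm u ^+ 2 = dot u u.
Proof. by rewrite sqr_sqrtr// dot_ge0. Qed.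

Lemma enormZ k u : 0 <= k -> enorm (k *: u) = k * enorm u.
Proof.
move=> k0; rewrite /enorm dotZl dotZr mulrA -expr2 sqrtrM ?sqr_ge0//.
by rewrite sqrtr_sqr ger0_norm.
Qed.

Lemma enorm_normalize u : u != 0 -> enorm (normalize u) = 1.
Proof.
move=> u0; rewrite /normalize enormZ ?invr_ge0 ?sqrtr_ge0// mulVf//.
by rewrite gt_eqF// enorm_gt0.
Qed.

Lemma normalize_unit u : enorm u = 1 -> normalize u = u.
Proof. by rewrite /normalize => ->; rewrite invr1 scale1r. Qed.

Lemma normalizeZ k u : 0 < k -> normalize (k *: u) = normalize u.
Proof.
move=> k0; rewrite /normalize enormZ ?ltW// scalerA invfM mulrAC.
by rewrite mulVf ?mul1r// gt_eqF.
Qed.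

Lemma scale_normalize u : enorm u *: normalize u = u.
Proof.
have [->|u0] := eqVneq u 0; first by rewrite /normalize !scaler0.
by rewrite /normalize scalerA mulfV ?scale1r// gt_eqF// enorm_gt0.
Qed.

Lemma normalize_neq0 u : u != 0 -> normalize u != 0.
Proof. by move=> u0; rewrite -enorm_gt0 enorm_normalize. Qed.

Lemma unit_neq0 u : enorm u = 1 -> u != 0.
Proof. by move=> u1; rewrite -enorm_gt0 u1. Qed.

Lemma unit_dot u : enorm u = 1 -> dot u u = 1.
Proof. by move=> u1; rewrite -enorm_sqr u1 expr1n. Qed.

Lemma dot_delta u i : dot u (delta_mx 0 i) = u 0 i.
Proof.
rewrite dotE (bigD1 i)//= big1 ?addr0 ?mxE ?eqxx ?mulr1// => j ji.
by rewrite mxE eqxx (negbTE ji) mulr0.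
Qed.

End DotProduct.

(** * Differentiation in several variables *)

Section Calculus.
Context {R : realType}.

Lemma is_derive_rowP {V : normedModType R} {m} (f : V -> 'rV[R]_m) x v df :
  is_derive x v f df <-> forall i, is_derive x v (fun y => f y 0 i) (df 0 i).
Proof.
split=> [[dfx <-] i|H].
  split; first by move/derivable_mxP : dfx; apply.
  by rewrite derive_mx// mxE.
have dfx : derivable f x v.
  by apply/derivable_mxP => i j; rewrite (ord1 i); exact: (@ex_derive _ _ _ _ _ _ _ (H j)).
split => //; rewrite derive_mx//; apply/rowP => i; rewrite mxE.
exact: (@derive_val _ _ _ _ _ _ _ (H i)).
Qed.

Lemma is_derive_scale {V : normedModType R} {m} (k : V -> R)
    (f : V -> 'rV[R]_m) x v dk df :
  is_derive x v k dk -> is_derive x v f df ->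
  is_derive x v (fun y => k y *: f y) (dk *: f x + k x *: df).
Proof.
move=> dkx /is_derive_rowP dfx; apply/is_derive_rowP => i.
rewrite !mxE; have := is_deriveM dkx (dfx i).
rewrite /GRing.scale/= => H.
have -> : (fun y => (k y *: f y) 0 i) = k * (fun y => f y 0 i).
  by apply/funext => y; rewrite mxE.
by apply: is_derive_eq; rewrite /GRing.scale/= addrC; congr (_ + _); rewrite mulrC.
Qed.

Lemma is_derive_dot {V : normedModType R} {m} (f g : V -> 'rV[R]_m) x v df dg :
  is_derive x v f df -> is_derive x v g dg ->
  is_derive x v (fun y => dot (f y) (g y)) (dot df (g x) + dot (f x) dg).
Proof.
move=> /is_derive_rowP dfx /is_derive_rowP dgx.
have H i := is_deriveM (dfx i) (dgx i).
have -> : (fun y => dot (f y) (g y)) =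
    \sum_i ((fun y => f y 0 i) * (fun y => g y 0 i)).
  by apply/funext => y; rewrite dotE fct_sumE.
have := is_derive_sum H; move=> H'; apply: is_derive_eq.
rewrite !dotE -big_split/=; apply: eq_bigr => i _.
by rewrite /GRing.scale/= addrC; congr (_ + _); rewrite mulrC.
Qed.

(** Differentiability of the inner map g in the single direction v is enough,
    since only its restriction to a line matters. *)
Lemma is_derive_comp {U V W : normedModType R} (f : V -> W) (g : U -> V)
    x v dg : is_derive x v g dg -> differentiable f (g x) ->
  is_derive x v (f \o g) ('D_dg f (g x)).
Proof.
move=> dgx dfx; have [dg1 dgE] := dgx.
pose gl (h : R) := g (h *: v + x).
have gl0 : gl 0 = g x by rewrite /gl scale0r add0r.
have dgl : derivable gl 0 1 by move/derivable1P : dg1.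
have diffgl : differentiable gl 0 by move/derivable1_diffP : dgl.
have dc : differentiable (f \o gl) 0.
  by apply: differentiable_comp => //; rewrite gl0.
have dline (Y : normedModType R) (k : U -> Y) :
    'D_v k x = 'D_1 (fun h : R => k (h *: v + x)) 0.
  rewrite /derive; set g1 := fun h => h^-1 *: _; set g2 := fun h => h^-1 *: _.
  suff -> : g1 = g2 by [].
  by apply/funext => h; rewrite /g1 /g2 /= addr0 scale0r add0r [_%:A]mulr1.
have dglE : 'D_1 gl 0 = dg by rewrite -dgE dline.
split.
  by apply/(@derivable1P _ _ _ (f \o g)); move/derivable1_diffP : dc.
rewrite dline -/(f \o gl) deriveE// diff_comp ?gl0//=.
by rewrite -(@deriveE _ _ _ gl 0 1 diffgl) dglE -deriveE.
Qed.

End Calculus.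

Section LineCalculus.
Context {R : realType}.

Lemma is_derive_line {V W : normedModType R} (f : V -> W) z v (s : R) df :
  is_derive (z + s *: v) v f df <->
  is_derive s 1 (fun h : R => f (z + h *: v)) df.
Proof.
have E : (fun h : R => h^-1 *: ((f \o shift (z + s *: v)) (h *: v)
                         - f (z + s *: v))) =
    (fun h : R => h^-1 *: (((fun h : R => f (z + h *: v)) \o shift s) (h *: 1)
                         - f (z + s *: v))).
  apply/funext => h /=; congr (_ *: (f _ - _)).
  by rewrite [_%:A]mulr1 scalerDl addrCA.
by split=> -[d1 d2]; split; move: d1 d2; rewrite /derivable /derive E.
Qed.

Lemma increment_le {V : normedModType R} (f : V -> R) z v (t e : R) :
  (forall s, `|s| <= `|t| ->
    derivable f (z + s *: v) v /\ `|'D_v f (z + s *: v)| <= e) ->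
  `|f (z + t *: v) - f z| <= e * `|t|.
Proof.
move=> H.
pose F (h : R) := f (z + h *: v).
have dF (s : R) : s \in `[0, 1] ->
    is_derive s 1 (fun s : R => F (s * t)) ('D_v f (z + (s * t) *: v) * t).
  rewrite in_itv/= => /andP[s0 s1].
  have [|d1 _] := H (s * t).
    by rewrite normrM ler_piMl// ger0_norm.
  have dF1 : is_derive (s * t) 1 F ('D_v f (z + (s * t) *: v)).
    by apply: (iffLR (is_derive_line f z v (s * t) _)); exact: derivableP.
  have dm : is_derive s 1 (fun s : R => s * t) t.
    have := is_deriveM (is_derive_id s (1 : R)) (is_derive_cst t s (1 : R)).
    move=> HH; apply: is_derive_eq.
    by rewrite /cst scaler0 add0r [_%:A]mulr1.
  exact: (@is_derive1_comp _ F (fun s => s * t) s).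
have cF : {within `[0, 1], continuous (fun s : R => F (s * t))}.
  by apply: derivable_within_continuous => s /dF[].
have dF' (s : R) : s \in `]0, 1[ ->
    is_derive s 1 (fun s : R => F (s * t)) ('D_v f (z + (s * t) *: v) * t).
  by rewrite in_itv/= => /andP[s0 s1]; apply: dF; rewrite in_itv/= !ltW.
have [] := MVT_segment ler01 dF' cF.
move=> c c01; rewrite /F mul0r mul1r scale0r addr0 subr0 mulr1 => ->.
rewrite normrM ler_wpM2r//.
move: c01; rewrite in_itv/= => /andP[c0 c1].
have [|_ //] := H (c * t).
by rewrite normrM ler_piMl// ger0_norm.
Qed.

End LineCalculus.

Section ContinuouslyDifferentiable.
Context {R : realType} {n : nat}.
Implicit Types (f r : 'rV[R]_n -> R) (x h : 'rV[R]_n).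

Definition truncate (k : nat) h : 'rV[R]_n :=
  \row_j (if (j < k)%N then h 0 j else 0).

Lemma rV_norm_le h (c : R) : 0 <= c ->
  (forall j, `|h 0 j| <= c) -> `|h| <= c.
Proof.
move=> c0 H; rewrite [leLHS]/Num.Def.normr/= mx_normrE.
by apply: bigmax_le => // -[i j] _ /=; rewrite (ord1 i).
Qed.

Lemma coord_norm_le h j : `|h 0 j| <= `|h|.
Proof.
rewrite [leRHS]/Num.Def.normr/= mx_normrE.
exact: (@le_bigmax _ _ _ _ _ (0, j)).
Qed.

(** Passing from x to x + h one coordinate at a time splits the increment of r
    into increments along coordinate axes, to which the mean value theorem
    applies. *)
Lemma near0_coords_differentiable r x :
  (forall i, \forall y \near x, derivable r y (delta_mx 0 i)) ->
  (forall i, 'D_(delta_mx 0 i) r y @[y --> x] --> 0) ->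
  differentiable r x.
Proof.
move=> dr r0.
suff H : r \o shift x = cst (r x) + (0 : 'rV[R]_n -> R^o)
    +o_ (0 : 'rV[R]_n) id.
  have c0 : continuous (0 : 'rV[R]_n -> R^o) by move=> ?; exact: cst_continuous.
  have d0 : 'd (r : _ -> R^o) x = 0 :> ('rV[R]_n -> R^o) by exact/diff_unique.
  by apply/diff_locallyP; rewrite d0.
apply/eqaddoP => e e0.
pose c := e / n.+1%:R.
have c0 : 0 < c by rewrite divr_gt0.
have near_c i : \forall y \near x,
    derivable r y (delta_mx 0 i) /\ `|'D_(delta_mx 0 i) r y| <= c.
  apply: filterI; first exact: dr.
  have /cvgrPdist_le/(_ _ c0) := r0 i; apply: filterS => y.
  by rewrite sub0r normrN.
have /nbhs_ballP[d/= d0 Hd] : \forall y \near x, forall i,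
    derivable r y (delta_mx 0 i) /\ `|'D_(delta_mx 0 i) r y| <= c.
  exact: (@filter_forall _ 'I_n (fun i y => derivable r y (delta_mx 0 i) /\
    `|'D_(delta_mx 0 i) r y| <= c) _ _ near_c).
have near_h : \forall h \near (0 : 'rV[R]_n), `|h| < d by exact: nbhs0_lt.
apply: filterS near_h => h hd.
rewrite -[X in `|X|]/(r (h + x) - (r x + 0)) addr0 [h + x]addrC.
have step k : (k <= n)%N ->
    `|r (x + truncate k h) - r x| <= k%:R * (c * `|h|).
  elim: k => [_|k IH kn].
    rewrite (_ : truncate 0 h = 0) ?addr0 ?subrr ?normr0 ?mul0r//.
    by apply/rowP => j; rewrite !mxE.
  pose i := Ordinal kn.
  have -> : truncate k.+1 h = truncate k h + h 0 i *: delta_mx 0 i.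
    apply/rowP => j; rewrite !mxE eqxx/= ltnS leq_eqVlt.
    have [->|ji] := eqVneq j i; first by rewrite eqxx/= ltnn add0r mulr1.
    have /negbTE-> : (j : nat) != k by apply: contra_neq ji => ?; exact: val_inj.
    by rewrite mulr0 addr0.
  rewrite [x + (_ + _)]addrA -(subrKA (r (x + truncate k h))) -natr1 mulrDl mul1r [leRHS]addrC.
  apply: le_trans (ler_normD _ _) _; apply: lerD; last by apply: IH; exact: ltnW.
  apply: le_trans (_ : c * `|h 0 i| <= _); last first.
    by rewrite ler_wpM2l ?(ltW c0)// coord_norm_le.
  apply: increment_le => s sh; apply: Hd.
  rewrite -ball_normE /ball_/= -addrA opprD addNKr normrN; apply: le_lt_trans hd.
  apply: rV_norm_le => // j; rewrite !mxE eqxx/=.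
  have [->|ji] := eqVneq j i.
    by rewrite /= ltnn add0r mulr1 (le_trans sh)// coord_norm_le.
  by rewrite mulr0 addr0; case: ifP => _; rewrite ?normr0 ?coord_norm_le.
have -> : h = truncate n h by apply/rowP => j; rewrite !mxE ltn_ord.
apply: le_trans (step n (leqnn _)) _.
rewrite (_ : truncate n h = h); last by apply/rowP => j; rewrite !mxE ltn_ord.
rewrite mulrA ler_wpM2r// /c mulrCA ler_piMr ?(ltW e0)//.
by rewrite ler_pdivrMr// mul1r ler_nat.
Qed.

(** Subtracting the linear function with the same partial derivatives at x
    leaves a function whose partial derivatives tend to 0 at x. *)
Lemma C1_differentiable f x :
  (forall i, \forall y \near x, derivable f y (delta_mx 0 i)) ->
  (forall i, {for x, continuous ('D_(delta_mx 0 i) f)}) ->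
  differentiable f x.
Proof.
move=> df cf.
pose a i := 'D_(delta_mx 0 i) f x.
pose g (y : 'rV[R]_n) := \sum_i a i *: (y 0 i : R).
have dg y : differentiable g y.
  have -> : g = \sum_i (a i *: (fun y : 'rV[R]_n => y 0 i : R)).
    by apply/funext => z; rewrite fct_sumE.
  apply: differentiable_sum => i; apply: differentiableZ.
  exact: differentiable_coord.
have Dg y i : 'D_(delta_mx 0 i) g y = a i.
  have -> : g = fun y => dot (\row_i a i) y.
    by apply/funext => z; rewrite dotE; apply: eq_bigr => j _; rewrite mxE.
  have := is_derive_dot (is_derive_cst (\row_i a i) y (delta_mx 0 i))
    (is_derive_id y (delta_mx 0 i)).
  by move=> [_ ->]; rewrite dot0l add0r dot_delta mxE.
have -> : f = (f - g) + g by rewrite subrK.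
apply: differentiableD => //; apply: near0_coords_differentiable => i.
  apply: filterS (df i) => y dy; apply: derivableB => //.
  exact: diff_derivable.
have : 'D_(delta_mx 0 i) f y - a i @[y --> x] --> 'D_(delta_mx 0 i) f x - a i.
  have cfi : 'D_(delta_mx 0 i) f y @[y --> x] --> 'D_(delta_mx 0 i) f x := cf i.
  by apply: cvgB cfi _; exact: cvg_cst.
rewrite subrr; apply: cvg_trans.
have H : \forall y \near x,
    'D_(delta_mx 0 i) f y - a i = 'D_(delta_mx 0 i) (f - g) y.
  apply: filterS (df i) => y dy; rewrite deriveB ?Dg//.
  exact: diff_derivable.
exact: (near_eq_cvg H).
Qed.

Lemma differentiable_rowP {V : normedModType R} {m} (f : V -> 'rV[R]_m) (x : V) :
  (forall i, differentiable (fun y => f y 0 i : R) x) -> differentiable f x.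
Proof.
move=> df.
have -> : f = \sum_i (fun y => f y 0 i *: delta_mx 0 i).
  by apply/funext => y; rewrite fct_sumE [LHS]row_sum_delta.
by apply: differentiable_sum => i; apply: differentiableZl.
Qed.

Lemma differentiable_coordT {V : normedModType R} {m} (f : V -> 'rV[R]_m) (x : V) i :
  differentiable f x -> differentiable (fun y => f y 0 i : R) x.
Proof.
move=> df; apply: (@differentiable_comp _ _ _ _ f (fun M : 'rV[R]_m => M 0 i)) => //.
exact: differentiable_coord.
Qed.

Lemma differentiable_dot {V : normedModType R} {m} (f g : V -> 'rV[R]_m) (x : V) :
  differentiable f x -> differentiable g x ->
  differentiable (fun y => dot (f y) (g y)) x.
Proof.
move=> df dg.
have -> : (fun y => dot (f y) (g y)) =
    \sum_i ((fun y => f y 0 i) * (fun y => g y 0 i)).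
  by apply/funext => y; rewrite dotE fct_sumE.
apply: differentiable_sum => i.
by apply: differentiableM; exact: differentiable_coordT.
Qed.

Lemma differentiable_scale {V : normedModType R} {m} (k : V -> R)
    (f : V -> 'rV[R]_m) (x : V) :
  differentiable k x -> differentiable f x ->
  differentiable (fun y => k y *: f y) x.
Proof.
move=> dk df; apply: differentiable_rowP => i.
have -> : (fun y => (k y *: f y) 0 i) = k * (fun y => f y 0 i).
  by apply/funext => y; rewrite mxE.
by apply: differentiableM => //; exact: differentiable_coordT.
Qed.

Lemma derive_dirE {W : normedModType R} (f : 'rV[R]_n -> W) x v :
  differentiable f x -> 'D_v f x = \sum_i v 0 i *: 'D_(delta_mx 0 i) f x.
Proof.
move=> df; rewrite deriveE// [v in LHS]row_sum_delta linear_sum.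
by apply: eq_bigr => i _; rewrite linearZ deriveE.
Qed.

Lemma dot_grad (f : 'rV[R]_n -> R) x v :
  differentiable f x -> dot (grad f x) v = 'D_v f x.
Proof.
move=> df; rewrite derive_dirE// dotE; apply: eq_bigr => i _.
by rewrite mxE mulrC.
Qed.

Lemma open_punctured : open (@punctured R n).
Proof.
rewrite /punctured (_ : [set x | _] = ~` [set 0]).
  by apply: closed_openC; exact: (accessible_closed_set1 (hausdorff_accessible (@norm_hausdorff _ _))).
by apply/seteqP; split => x /eqP.
Qed.

Lemma near_punctured x : x != 0 -> \forall y \near x, y != 0.
Proof. by move=> x0; have := open_punctured; rewrite openE => /(_ _ x0). Qed.

Lemma smooth_on_differentiable f x : smooth_on punctured f -> x != 0 ->
  differentiable f x.
Proof.
move=> sf x0; apply: C1_differentiable => i.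
  by apply: filterS (near_punctured x0) => y y0; have [_] := sf [::] _ y0; apply.
by have [] := sf [:: delta_mx 0 i] _ x0.
Qed.

Lemma smooth_on_derive_differentiable f x v : smooth_on punctured f -> x != 0 ->
  differentiable ('D_v f) x.
Proof.
move=> sf x0; apply: smooth_on_differentiable => // vs y y0.
have := sf (rcons vs v) y y0.
suff -> : iter_derive (rcons vs v) f = iter_derive vs ('D_v f) by [].
by elim: vs => //= u vs ->.
Qed.

Lemma smooth_on_grad_differentiable f x : smooth_on punctured f -> x != 0 ->
  differentiable (grad f) x.
Proof.
move=> sf x0; apply: differentiable_rowP => i.
have -> : (fun y => grad f y 0 i) = 'D_(delta_mx 0 i) f.
  by apply/funext => y; rewrite mxE.
exact: smooth_on_derive_differentiable.
Qed.

Lemma smooth_on_map_differentiable (f : 'rV[R]_n -> 'rV[R]_n) x :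
  smooth_on punctured f -> x != 0 -> differentiable f x.
Proof.
move=> sf x0; apply: differentiable_rowP => j.
have H y i : y != 0 -> is_derive y (delta_mx 0 i) (fun y => f y 0 j)
    ('D_(delta_mx 0 i) f y 0 j).
  move=> y0; apply: (iffLR (is_derive_rowP _ _ _ _)).
  by apply: derivableP; have [_] := sf [::] _ y0; apply.
apply: C1_differentiable => i.
  by apply: filterS (near_punctured x0) => y /(H _ i)[].
have [c1 _] := sf [:: delta_mx 0 i] _ x0.
have Ex : 'D_(delta_mx 0 i) (fun y => f y 0 j) x = 'D_(delta_mx 0 i) f x 0 j.
  by have [] := H x i x0.
have c2 : ('D_(delta_mx 0 i) f y) 0 j @[y --> x] --> ('D_(delta_mx 0 i) f x) 0 j.
  exact: (cvg_comp _ _ c1 (@coord_continuous _ _ _ 0 j _)).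
have H' : \forall y \near x, ('D_(delta_mx 0 i) f y) 0 j =
    'D_(delta_mx 0 i) (fun y => f y 0 j) y.
  by apply: filterS (near_punctured x0) => y /(H _ i)[].
rewrite -Ex in c2; apply: cvg_trans c2.
exact: (near_eq_cvg H').
Qed.

End ContinuouslyDifferentiable.

(** * Curves in level sets *)

Section Lifting.
Context {R : realType}.

Lemma near_eq_differentiable {V W : normedModType R} (f g : V -> W) x :
  (\forall y \near x, f y = g y) -> differentiable f x -> differentiable g x.
Proof.
move=> fg df.
have cd := diff_continuous df.
have fgx : f x = g x by exact: nbhs_singleton fg.
have H : g \o shift x = cst (g x) + 'd f x +o_ 0 id.
  apply/eqaddoP => e e0.
  have /eqaddoP/(_ _ e0) := diff_locally df.
  have : \forall h \near (0 : V), f (h + x) = g (h + x).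
    by move: fg; rewrite (near_shift 0) /= subr0.
  apply: filterS2 => h fgh.
    by rewrite -[X in `|X| <= _]/(f (h + x) - (f x + 'd f x h)) fgh fgx.
by apply/diff_locallyP; rewrite (diff_unique cd H).
Qed.

Lemma derive_sign (G : R -> R) d : is_derive (0 : R) (1 : R) G d -> G 0 = 0 ->
  0 < d -> \forall s \near 0, s != 0 -> 0 < s * G s.
Proof.
move=> [dG dGE] G0 d0.
have d20 : 0 < d / 2 by rewrite divr_gt0.
have /derivable_nbhs := dG; rewrite dGE => /eqaddoP/(_ _ d20).
apply: filterS => s; rewrite -[X in `|X| <= _]/(G (s * 1 + 0) - (G 0 + s * d)).
rewrite G0 add0r addr0 mulr1 => H s0.
have : `|s * G s - s * (s * d)| <= d / 2 * s ^+ 2.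
  rewrite -mulrBr normrM -[s ^+ 2]real_normK ?num_real// expr2 mulrCA.
  by rewrite ler_wpM2l.
rewrite ler_norml => /andP[H1 _].
have s2 : 0 < s ^+ 2 by rewrite exprn_even_gt0.
have : 0 < d * s ^+ 2 by rewrite mulr_gt0.
move: H1; have -> : s * (s * d) = d * s ^+ 2 by ring.
lra.
Qed.

Lemma is_derive_affine {V : normedModType R} (x v : V) (s : R) :
  is_derive s 1 (fun h : R => x + h *: v) v.
Proof.
have : is_derive (x + s *: v) v (@id V) v by exact: is_derive_id.
by move/is_derive_line.
Qed.

(** A substitute for the implicit function theorem that needs differentiability
    at x0 and mere continuity nearby.  To first order the equation
    f (x0 + s v + t nu) = phi s has the solution t = m s; since f increases at x0
    in the direction nu, the intermediate value theorem gives true solutions at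
    distance o(s) from it. *)
Lemma lift_curve {V : normedModType R} (f : V -> R) x0 nu v (phi : R -> R) dphi :
  differentiable f x0 -> (\forall y \near x0, {for y, continuous f}) ->
  0 < 'D_nu f x0 -> phi 0 = f x0 -> is_derive (0 : R) (1 : R) phi dphi ->
  exists c : R -> V, [/\ c 0 = x0,
    is_derive (0 : R) 1 c (v + ((dphi - 'D_v f x0) / 'D_nu f x0) *: nu) &
    \forall s \near (0 : R), f (c s) = phi s].
Proof.
move=> df cf dnu phi0 dphi0.
set m := (_ / _); pose v' := v + m *: nu.
have dv' : 'D_v' f x0 = dphi.
  rewrite deriveE// linearD linearZ /= -!deriveE// /m /GRing.scale/=.
  by rewrite divfK ?gt_eqF// addrC subrK.
(* The direction v' absorbs the first order term, so that t only corrects it. *)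
pose Z (s : R) : set R := [set t | f (x0 + s *: v' + t *: nu) = phi s].
have small (e : R) : 0 < e ->
    \forall s \near (0 : R), exists2 t, Z s t & `|t| <= e * `|s|.
  move=> e0.
  have G (k : R) : is_derive (0 : R) (1 : R)
      (fun s => f (x0 + s *: (v' + k *: nu)) - phi s) (k * 'D_nu f x0).
    have dx : differentiable f (x0 + (0 : R) *: (v' + k *: nu)).
      by rewrite scale0r addr0.
    have H1 := is_derive_comp (is_derive_affine x0 (v' + k *: nu) 0) dx.
    have H2 := is_deriveB H1 dphi0; apply: is_derive_eq.
    rewrite scale0r addr0 [in LHS]deriveE// linearD linearZ /= -!deriveE// dv'.
    by rewrite /GRing.scale/= addrAC subrr add0r.
  have G0 (k : R) : f (x0 + 0 *: (v' + k *: nu)) - phi 0 = 0.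
    by rewrite scale0r addr0 phi0 subrr.
  have P1 := derive_sign (G e) (G0 e) (mulr_gt0 e0 dnu).
  have G2 : is_derive (0 : R) (1 : R)
      (fun s => - (f (x0 + s *: (v' + (- e) *: nu)) - phi s)) (e * 'D_nu f x0).
    by have := is_deriveN (G (- e)); rewrite mulNr opprK.
  have P2 := derive_sign G2 (etrans (congr1 -%R (G0 (- e))) (oppr0 R))
    (mulr_gt0 e0 dnu).
  have /nbhs_ballP[d/= d0 Hd] := cf.
  have Pc : \forall s \near (0 : R), `|s| * (`|v'| + e * `|nu|) < d.
    pose M := `|v'| + e * `|nu| + 1.
    have M0 : 0 < M by rewrite ltr_pwDr// addr_ge0// mulr_ge0// ltW.
    have : \forall s \near (0 : R), `|s| < d / M by apply: nbhs0_lt; rewrite divr_gt0.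
    apply: filterS => s; rewrite ltr_pdivlMr//; apply: le_lt_trans.
    by rewrite ler_wpM2l// /M lerDl.
  near=> s.
  have [->|s0] := eqVneq s 0.
    by exists 0; rewrite ?normr0 ?mulr0// /Z /= !scale0r !addr0.
  have Q1 : 0 < s * (f (x0 + s *: (v' + e *: nu)) - phi s).
    by move: s0; near: s.
  have Q2 : 0 < s * - (f (x0 + s *: (v' + (- e) *: nu)) - phi s).
    by move: s0; near: s.
  have Q3 : `|s| * (`|v'| + e * `|nu|) < d by near: s.
  pose H (t : R) := f (x0 + s *: v' + t *: nu).
  have He (k : R) : f (x0 + s *: (v' + k *: nu)) = H (s * k).
    by rewrite /H scalerDr scalerA addrA.
  rewrite !He in Q1 Q2.
  have cH : {within `[- (e * `|s|), e * `|s|], continuous H}.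
    apply/continuous_in_subspaceT => t; rewrite inE/= in_itv/= => /andP[t1 t2].
    apply: continuous_comp.
      apply: differentiable_continuous; apply/derivable1_diffP.
      by have [] := is_derive_affine (x0 + s *: v') nu t.
    apply: Hd; rewrite -ball_normE /ball_/= -addrA opprD addNKr normrN.
    apply: le_lt_trans Q3; apply: le_trans (ler_normD _ _) _.
    rewrite !normrZ mulrDr lerD// mulrA ler_wpM2r// mulrC ler_norml.
    by rewrite t1 t2.
  have [] := @IVT R H (- (e * `|s|)) (e * `|s|) (phi s) _ cH _.
  - by rewrite ge0_cp// mulr_ge0// ltW.
  - have [sp|sn] := ltP 0 s.
      rewrite gtr0_norm//; move: Q1 Q2; rewrite !pmulr_rgt0// mulrN [s * e]mulrC.
      by rewrite ge_min le_max; lra.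
    have sn' : s < 0 by rewrite lt_neqAle s0.
    rewrite ltr0_norm//; move: Q1 Q2; rewrite !nmulr_rgt0// !mulrN opprK [s * e]mulrC.
    by rewrite ge_min le_max; lra.
  - move=> t; rewrite in_itv/= => tI Ht; exists t => //.
    by rewrite ler_norml.
(* A solution need not be unique; one of size within s ^ 2 of the least
   possible is o(s), whichever is chosen. *)
have choose (s : R) : exists t : R, Z s !=set0 ->
    (s = 0 -> t = 0) /\ Z s t /\ forall t', Z s t' -> `|t| <= `|t'| + s ^+ 2.
  have [->|s0] := eqVneq s 0.
    exists 0 => _; split => //; split.
      by rewrite /Z /= !scale0r !addr0.
    by move=> t' _; rewrite normr0 addr_ge0// sqr_ge0.
  have [[t0 Zt0]|nZ] := pselect (Z s !=set0); last by exists 0.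
  have s2 : 0 < s ^+ 2 by rewrite exprn_even_gt0.
  have hi : has_inf [set `|t| | t in Z s].
    by split; [exists `|t0|, t0|exists 0 => _ [t _ <-]].
  have [_ [t Zt <-] Ht] := inf_adherent s2 hi.
  exists t => _; split; first by move=> s0'; rewrite s0' eqxx in s0.
  split=> // t' Zt'; apply: (le_trans (ltW Ht)); rewrite lerD2r.
  apply: ge_inf; last by exists t'.
  by have [] := hi.
have [t Ht] := choice choose.
have tZ : \forall s \near (0 : R), Z s (t s).
  have := small _ ltr01; apply: filterS => s [t' Zt' _].
  by have [|_ []] := Ht s; first by exists t'.
have t00 : t 0 = 0.
  have [|-> //] := Ht 0.
  by exists 0; rewrite /Z /= !scale0r !addr0.
have dt : is_derive (0 : R) (1 : R) t 0.
  suff C : (fun h : R => h^-1 *: ((t \o shift 0) (h *: 1) - t 0)) @ 0^' --> (0 : R).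
    by split; [apply/cvg_ex; exists 0|exact/cvg_lim].
  apply/cvgrPdist_le => e e0; apply: cvg_within.
  have e2 : 0 < e / 2 by rewrite divr_gt0.
  have hse : \forall s \near (0 : R), `|s| <= e / 2 by exact: nbhs0_le.
  near=> s; rewrite sub0r normrN t00 subr0 /= addr0 [_%:A]mulr1.
  have [->|s0] := eqVneq s 0; first by rewrite invr0 scale0r normr0 ltW.
  have [t' Zt' t'e] : exists2 t', Z s t' & `|t'| <= e / 2 * `|s|.
    by near: s; exact: small.
  have [|_ [_ Hs]] := Ht s; first by exists t'.
  have {}Hs := Hs _ Zt'.
  have se : `|s| <= e / 2 by near: s; exact: hse.
  rewrite normrZ normfV ler_pdivrMl ?normr_gt0//.
  apply: (le_trans Hs); rewrite -real_normK ?num_real//.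
  have : `|s| ^+ 2 <= e / 2 * `|s| by rewrite expr2 ler_wpM2r.
  move: t'e; lra.
exists (fun s => x0 + s *: v' + t s *: nu); split.
- by rewrite scale0r t00 scale0r !addr0.
- have D2 : is_derive (0 : R) 1 (fun s => t s *: nu) 0.
    have [/derivable1_diffP dl _] := is_derive_affine (0 : V) nu (t 0).
    have := is_derive_comp dt dl; rewrite derive0.
    have -> // : (fun h : R => 0 + h *: nu) \o t = fun s => t s *: nu.
    by apply/funext => s /=; rewrite add0r.
  have := is_deriveD (is_derive_affine x0 v' 0) D2.
  by rewrite addr0.
- exact: tZ.
Unshelve. all: by end_near. Qed.

End Lifting.

(** * The unit sphere and its great circles *)

Section Normalization.
Context {R : realType} {n : nat}.
Implicit Types (x y w : 'rV[R]_n).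

Lemma differentiable_enorm x : x != 0 -> differentiable (@enorm R n) x.
Proof.
move=> x0; have d0 : 0 < dot x x by rewrite dot_gt0.
apply: (@differentiable_comp _ _ _ _ (fun y => dot y y) Num.sqrt).
  by apply: differentiable_dot.
by apply/derivable1_diffP; have [] := is_derive1_sqrt d0.
Qed.

Lemma differentiable_normalize x : x != 0 ->
  differentiable (@normalize R n) x.
Proof.
move=> x0; apply: differentiable_scale => //.
apply: differentiableV; first exact: differentiable_enorm.
by rewrite gt_eqF// enorm_gt0.
Qed.

Lemma derive_dot_self x w : is_derive x w (fun y => dot y y) (2 * dot x w).
Proof.
have := is_derive_dot (is_derive_id x w) (is_derive_id x w) => H.
by apply: is_derive_eq; rewrite /= [dot w x]dotC mulr_natl mulr2n.
Qed.

Lemma derive_normalize_tangent x w : enorm x = 1 -> dot w x = 0 ->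
  'D_w (@normalize R n) x = w.
Proof.
move=> x1 wx; have x0 := unit_neq0 x1.
have dk : differentiable (fun y => (@enorm R n y)^-1) x.
  apply: differentiableV; first exact: differentiable_enorm.
  by rewrite x1 oner_neq0.
have kw : 'D_w (fun y => (@enorm R n y)^-1) x = 0.
  have := deriveV (v := w) (f := @enorm R n) (x := x).
  rewrite x1 oner_neq0 => -> //; last exact/diff_derivable/differentiable_enorm.
  have d0 : 0 < dot x x by rewrite dot_gt0.
  have [/derivable1_diffP ds _] := is_derive1_sqrt d0.
  have [_ E] := is_derive_comp (derive_dot_self x w) ds.
  have -> : 'D_w (@enorm R n) x = 0 by rewrite [LHS]E [dot x w]dotC wx mulr0 derive0.
  by rewrite scaler0.
have := is_derive_scale (derivableP (v := w) (diff_derivable dk)) (is_derive_id x w).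
by case=> _; rewrite kw x1 invr1 scale0r add0r scale1r.
Qed.

(** Differentiate f y = c f (y / k). *)
Lemma derive_homogeneous {W : normedModType R} (f : 'rV[R]_n -> W) (k c : R) x w :
  k != 0 -> (forall y, f (k *: y) = c *: f y) -> differentiable f x ->
  is_derive (k *: x) w f ((c / k) *: 'D_w f x).
Proof.
move=> k0 fk df.
pose h y := k^-1 *: y : 'rV[R]_n.
have fE : f = fun y => c *: f (h y).
  by apply/funext => y; rewrite -fk /h scalerA divff// scale1r.
have hx : h (k *: x) = x by rewrite /h scalerA mulVf// scale1r.
have dh : is_derive (k *: x) w h (k^-1 *: w).
  exact: (is_deriveZ k^-1 (is_derive_id (k *: x) w)).
have dfh : differentiable f (h (k *: x)) by rewrite hx.
have := is_deriveZ c (is_derive_comp dh dfh).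
rewrite hx => H; rewrite {1}fE; apply: is_derive_eq.
by rewrite deriveE// linearZ /= scalerA -deriveE.
Qed.

End Normalization.

Section Geodesic.
Context {R : realType} {n : nat}.

(** The acceleration is normal to the sphere and <g'', g> = - <g', g'> = - 1, so
    that g'' = - g; then cos s g - sin s g' and sin s g + cos s g' are constant. *)
Lemma geodesic_great_circle (g : R -> 'rV[R]_n) : sphere_geodesic g ->
  exists A B : 'rV[R]_n, forall s : R,
    [/\ is_derive s (1 : R) g (derive1 g s), g s = cos s *: A + sin s *: B &
        derive1 g s = cos s *: B - sin s *: A].
Proof.
move=> [sm geo].
have dg s : is_derive s (1 : R) g (derive1 g s).
  by rewrite derive1E; apply: derivableP; have [_] := sm [::] s I; apply.
have dg' s : is_derive s (1 : R) (derive1 g) (derive1 (derive1 g) s).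
  rewrite derive1E; apply: derivableP; have [_] := sm [:: 1] s I.
  rewrite /= (_ : 'D_1 g = derive1 g); first exact.
  by apply/funext => t; rewrite derive1E.
have gg s : dot (g s) (g s) = 1.
  by have [us _ _] := geo s; exact: unit_dot.
have g'g' s : dot (derive1 g s) (derive1 g s) = 1.
  by have [_ us _] := geo s; exact: unit_dot.
have gg' s : dot (derive1 g s) (g s) = 0.
  have [_] := is_derive_dot (dg s) (dg s).
  have -> : (fun y : R => dot (g y) (g y)) = cst 1 by apply/funext => t; rewrite gg.
  rewrite derive_cst [dot (g s) _]dotC; lra.
have gg'' s : dot (derive1 (derive1 g) s) (g s) = -1.
  have [_] := is_derive_dot (dg' s) (dg s).
  have -> : (fun y : R => dot (derive1 g y) (g y)) = cst 0.
    by apply/funext => t; rewrite gg'.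
  rewrite derive_cst g'g'; lra.
have g'' s : derive1 (derive1 g) s = - g s.
  have [_ _ H] := geo s.
  have vg : dot (derive1 (derive1 g) s + g s) (g s) = 0.
    by rewrite dotDl gg'' gg addNr.
  apply/eqP; rewrite -addr_eq0 -dot_eq0 {2}[_ + g s]addrC dotDr.
  by rewrite vg add0r H.
pose A s := cos s *: g s - sin s *: derive1 g s.
pose B s := sin s *: g s + cos s *: derive1 g s.
have cstrow (f : R -> 'rV[R]_n) : (forall s, is_derive s (1 : R) f 0) ->
    forall s, f s = f 0.
  move=> df s; apply/rowP => i.
  apply: (@is_derive_0_is_cst R (fun s => f s 0 i)) => t.
  by have /is_derive_rowP/(_ i) := df t; rewrite mxE.
have AE s : A s = A 0.
  apply: (cstrow A) => t.
  have := is_deriveB (is_derive_scale (is_derive_cos t) (dg t))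
    (is_derive_scale (is_derive_sin t) (dg' t)).
  move=> H; apply: is_derive_eq; rewrite g''.
  by apply/rowP => i; rewrite !mxE; ring.
have BE s : B s = B 0.
  apply: (cstrow B) => t.
  have := is_deriveD (is_derive_scale (is_derive_sin t) (dg t))
    (is_derive_scale (is_derive_cos t) (dg' t)).
  move=> H; apply: is_derive_eq; rewrite g''.
  by apply/rowP => i; rewrite !mxE; ring.
exists (A 0), (B 0) => s; split=> //; rewrite -(AE s) -(BE s).
- apply/rowP => i; rewrite !mxE.
  have := cos2Dsin2 s; set c := cos s; set t := sin s => ct.
  transitivity ((c ^+ 2 + t ^+ 2) * g s 0 i); last by ring.
  by rewrite ct mul1r.
- apply/rowP => i; rewrite !mxE.
  have := cos2Dsin2 s; set c := cos s; set t := sin s => ct.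
  transitivity ((c ^+ 2 + t ^+ 2) * derive1 g s 0 i); last by ring.
  by rewrite ct mul1r.
Qed.

End Geodesic.

(** * Regular points of an isoparametric function *)

Lemma near_comp {T U : topologicalType} (f : T -> U) x (P : U -> Prop) :
  {for x, continuous f} -> (\forall y \near f x, P y) ->
  \forall z \near x, P (f z).
Proof. by move=> cf Py; exact: (cf _ Py). Qed.

Lemma orthogonal_expansion {R : realType} {n : nat} (x v y : 'rV[R]_n) :
  x != 0 -> dot v v = 1 -> dot v x = 0 ->
  (forall w, dot w x = 0 -> dot w v = 0 -> dot w y = 0) ->
  y = (dot y x / dot x x) *: x + dot y v *: v.
Proof.
move=> x0 vv vx H.
have xx : dot x x != 0 by rewrite dot_eq0.
pose w := y - ((dot y x / dot x x) *: x + dot y v *: v).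
have wx : dot w x = 0.
  by rewrite /w !dotlin vx mulr0 addr0 divfK// subrr.
have wv : dot w v = 0.
  by rewrite /w !dotlin vv [dot x v]dotC vx mulr0 add0r mulr1 subrr.
apply/eqP; rewrite -subr_eq0 -/w -dot_eq0 {2}/w dotDr dotNr dotDr !dotZr.
by rewrite wx wv (H _ wx wv) !mulr0 addr0 subr0.
Qed.

Section RegularPoints.
Context {R : realType} {n d : nat}.
Context (M : R -> set 'rV[R]_n) (p : 'rV[R]_n -> R).
Context (hp : isoparametric_polynomial d p).
Context (hS : forall s : R, -1 <= s <= 1 ->
  exists t, param_interval d t /\ M t = level_set p s).
Context (h01 : (M 0 = level_set p 1 /\ M (pi / d%:R) = level_set p (-1)) \/
  (M 0 = level_set p (-1) /\ M (pi / d%:R) = level_set p 1)).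
Implicit Types (x y w u : 'rV[R]_n).

Local Notation pt := (radial_ext p).
Local Notation nu := (unit_normal p).

Definition regular x := x != 0 /\ -1 < pt x < 1.

Lemma radial_extZ k x : 0 < k -> pt (k *: x) = pt x.
Proof. by move=> k0; rewrite /radial_ext /= normalizeZ. Qed.

Lemma radial_ext_unit x : enorm x = 1 -> pt x = p x.
Proof. by move=> x1; rewrite /radial_ext /= normalize_unit. Qed.

Lemma radial_ext_differentiable x : x != 0 -> differentiable pt x.
Proof. exact/smooth_on_differentiable/(isop_smooth (isopol_isop hp)). Qed.

Lemma near_radial_ext_continuous x : x != 0 ->
  \forall y \near x, {for y, continuous pt}.
Proof.
move=> x0; apply: filterS (near_punctured x0) => y y0.
exact/differentiable_continuous/radial_ext_differentiable.
Qed.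

Lemma regularZ k x : 0 < k -> regular (k *: x) <-> regular x.
Proof.
move=> k0; rewrite /regular radial_extZ// scaler_eq0 negb_or gt_eqF//.
Qed.

Lemma regular_neq0 x : regular x -> x != 0. Proof. by case. Qed.

Lemma near_regular x : regular x -> \forall y \near x, regular y.
Proof.
move=> [x0 /andP[p1 p2]].
have cpt : {for x, continuous pt} by exact/differentiable_continuous/radial_ext_differentiable.
have P1 : \forall y \near x, pt y < 1 by exact: (cvgr_lt (pt x) cpt _ p2).
have P2 : \forall y \near x, -1 < pt y by exact: (cvgr_gt (pt x) cpt _ p1).
near=> y; split; first by near: y; exact: near_punctured.
by apply/andP; split; near: y.
Unshelve. all: by end_near. Qed.

Lemma focalE x : focal d M x <-> enorm x = 1 /\ (p x = 1 \/ p x = -1).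
Proof.
rewrite /focal; case: h01 => -[-> ->]; rewrite /level_set /usphere /=;
by split=> [[[? ->]|[? ->]]|[? [->|->]]]; tauto.
Qed.

Lemma radial_ext_range x : x != 0 -> -1 <= pt x <= 1.
Proof. by move=> x0; apply: (isopol_range hp); exact: enorm_normalize. Qed.

Lemma regular_pointsE x : regular_points d M x <-> regular x.
Proof.
split=> [H|[x0 /andP[p1 p2]] [l [y [l0 /focalE[y1 yf] xE]]]].
  have x0 : x != 0.
    apply/eqP => x0; apply: H.
    have [y [y1 py _]] : critical_value p 1 by apply/(isopol_critical hp); left.
    exists 0, y; split=> //; last by rewrite scale0r.
    by apply/focalE; split=> //; left.
  split=> //; have /andP[p1 p2] := radial_ext_range x0.
  rewrite !lt_neqAle p1 p2 !andbT; apply/andP; split; apply/eqP => E; apply: H;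
    exists (enorm x), (normalize x); rewrite scale_normalize sqrtr_ge0; split=> //;
    apply/focalE; rewrite enorm_normalize//; split=> //.
    by right.
  by left.
have l1 : 0 < l.
  by rewrite lt_neqAle l0 andbT eq_sym; apply: contraNneq x0 => l00; rewrite xE l00 scale0r.
move: p1 p2; rewrite xE radial_extZ// radial_ext_unit//.
by case: yf => ->; rewrite ltxx.
Qed.

Lemma regular_unit x : enorm x = 1 -> regular x <-> ~ focal d M x.
Proof.
move=> x1; rewrite focalE; have x0 := unit_neq0 x1.
have := radial_ext_range x0; rewrite /regular radial_ext_unit// => /andP[p1 p2].
split=> [[_ /andP[q1 q2]] [_ [E|E]]|H].
- by rewrite E ltxx in q2.
- by rewrite E ltxx in q1.
- split=> //; rewrite !lt_neqAle p1 p2 !andbT; apply/andP; split; apply/eqP => E; apply: H; split=> //.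
    by right.
  by left.
Qed.

Lemma sgradZ k x : 0 < k -> x != 0 -> sgrad p (k *: x) = k^-1 *: sgrad p x.
Proof.
move=> k0 x0; apply/rowP => i; rewrite !mxE.
have := @derive_homogeneous R n R pt k 1 x (delta_mx 0 i).
move=> []; rewrite ?gt_eqF//.
- by move=> y; rewrite radial_extZ// scale1r.
- exact: radial_ext_differentiable.
- by move=> _ ->; rewrite div1r.
Qed.

Lemma unit_normalZ k x : 0 < k -> x != 0 -> nu (k *: x) = nu x.
Proof.
by move=> k0 x0; rewrite /unit_normal sgradZ// normalizeZ// invr_gt0.
Qed.

(** The only critical values of p are those of the focal submanifolds. *)
Lemma sgrad_neq0 x : regular x -> sgrad p x != 0.
Proof.
move=> [x0 pt1].
suff H : sgrad p (normalize x) != 0.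
  apply: contra_neq H => H; rewrite /normalize sgradZ ?H ?scaler0//.
  by rewrite invr_gt0 enorm_gt0.
apply/eqP => s0.
have : critical_value p (pt x).
  by exists (normalize x); split=> //; exact: enorm_normalize.
move/(isopol_critical hp) => [] E; move: pt1; rewrite E ltxx ?andbF//.
Qed.

Lemma enorm_unit_normal x : regular x -> enorm (nu x) = 1.
Proof. by move=> rx; apply: enorm_normalize; exact: sgrad_neq0. Qed.

Lemma dot_unit_normal x : regular x -> dot (nu x) (nu x) = 1.
Proof. by move=> rx; apply/unit_dot/enorm_unit_normal. Qed.

(** The extension of p is constant along rays. *)
Lemma sgrad_radial x : x != 0 -> dot (sgrad p x) x = 0.
Proof.
move=> x0; rewrite /sgrad dot_grad; last exact: radial_ext_differentiable.
have x0' : x + 0 *: x != 0 by rewrite scale0r addr0.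
have [_] : is_derive (0 : R) 1 (fun h : R => pt (x + h *: x)) ('D_x pt (x + 0 *: x)).
  apply: (iffLR (is_derive_line pt x x 0 _)); apply/derivableP/diff_derivable.
  exact: radial_ext_differentiable.
rewrite scale0r addr0 => <-.
have : \forall h \near (0 : R), cst (pt x) h = pt (x + h *: x).
  have : \forall h \near (0 : R), `|h| < 1 by exact: nbhs0_lt.
  apply: filterS => h; rewrite ltr_norml => /andP[h1 _].
  rewrite -[X in X + _]scale1r -scalerDl radial_extZ//; lra.
by move/near_eq_derive => <-; rewrite derive_cst.
Qed.

Lemma unit_normal_radial x : x != 0 -> dot (nu x) x = 0.
Proof.
by move=> x0; rewrite /unit_normal /normalize dotZl sgrad_radial// mulr0.
Qed.

Lemma sgradE x : sgrad p x = enorm (sgrad p x) *: nu x.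
Proof. by rewrite scale_normalize. Qed.

Lemma derive_radial_ext x w : x != 0 ->
  'D_w pt x = enorm (sgrad p x) * dot (nu x) w.
Proof.
move=> x0; rewrite -dot_grad; last exact: radial_ext_differentiable.
by rewrite -dotZl -sgradE.
Qed.

Lemma derive_radial_ext_normal x : regular x -> 0 < 'D_(nu x) pt x.
Proof.
move=> rx; rewrite derive_radial_ext ?(regular_neq0 rx)//.
by rewrite dot_unit_normal// mulr1 enorm_gt0 sgrad_neq0.
Qed.

Lemma unit_normal_differentiable x : regular x -> differentiable nu x.
Proof.
move=> rx; apply: (@differentiable_comp _ _ _ _ (sgrad p) (@normalize R n)).
  apply: smooth_on_grad_differentiable; last exact: regular_neq0.
  exact: (isop_smooth (isopol_isop hp)).
exact/differentiable_normalize/sgrad_neq0.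
Qed.

(** The span of x and nu x when x is regular (in_normal_planeP).  Stated by
    orthogonality, it is visibly a closed condition and passes to derivatives. *)
Definition in_normal_plane x y :=
  forall w, dot w x = 0 -> dot w (nu x) = 0 -> dot w y = 0.

Lemma in_normal_planeP x y : regular x -> in_normal_plane x y ->
  y = (dot y x / dot x x) *: x + dot y (nu x) *: nu x.
Proof.
rewrite /in_normal_plane => rx.
have := unit_normal_radial (regular_neq0 rx); have := dot_unit_normal rx.
exact/orthogonal_expansion/regular_neq0.
Qed.

Lemma in_normal_plane_lin x a b : in_normal_plane x (a *: x + b *: nu x).
Proof. by move=> w wx wn; rewrite dotDr dotZr [X in _ + X]dotZr wx wn !mulr0 addr0. Qed.

Lemma in_normal_plane_self x : in_normal_plane x x.
Proof. by move=> w. Qed.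

Lemma in_normal_planeZ k x y : 0 < k -> x != 0 ->
  in_normal_plane (k *: x) y <-> in_normal_plane x y.
Proof.
move=> k0 x0; rewrite /in_normal_plane unit_normalZ//.
split=> H w wx wn; apply: H => //; first by rewrite dotZr wx mulr0.
by move/eqP: wx; rewrite dotZr mulf_eq0 gt_eqF//= => /eqP.
Qed.

(** The correction that keeps a curve on the level set of p has no first order
    term when w is orthogonal to nu x. *)
Lemma leaf_curve x w : regular x -> dot (nu x) w = 0 ->
  exists c : R -> 'rV[R]_n, [/\ c 0 = x, is_derive (0 : R) 1 c w &
    \forall s \near (0 : R), pt (c s) = pt x].
Proof.
move=> rx wn; have x0 := regular_neq0 rx.
have [c [c0 dc Hc]] := lift_curve w (radial_ext_differentiable x0)
  (near_radial_ext_continuous x0) (derive_radial_ext_normal rx) (erefl (cst (pt x) 0))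
  (is_derive_cst (pt x) (0 : R) (1 : R)).
exists c; split=> //.
by move: dc; rewrite derive_radial_ext// wn mulr0 subrr mul0r scale0r addr0.
Qed.

Lemma is_derive_continuous0 (c : R -> 'rV[R]_n) w : is_derive (0 : R) 1 c w ->
  {for (0 : R), continuous c}.
Proof. by move=> [/derivable1_diffP dc _]; exact: differentiable_continuous. Qed.

(** Orthogonality of a geodesic to the leaves is expressed with velocities of
    curves in the leaves; this lemma provides enough of them. *)
Lemma level_tangent x w : enorm x = 1 -> regular x -> dot w x = 0 ->
  dot w (nu x) = 0 -> tangent_vector (level_set p (p x)) x w.
Proof.
move=> x1 rx wx wn.
have [c [c0 dc Hc]] : exists c : R -> 'rV[R]_n, [/\ c 0 = x, is_derive (0 : R) 1 c w &
    \forall s \near (0 : R), pt (c s) = pt x].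
  by apply: leaf_curve => //; rewrite dotC.
exists (@normalize R n \o c); split.
- by rewrite /= c0 normalize_unit.
- have cc := is_derive_continuous0 dc.
  have c_neq0 : \forall s \near (0 : R), c s != 0.
    by apply: (near_comp (P := fun y => is_true (y != 0)) cc); rewrite c0; exact/near_punctured/regular_neq0.
  near=> s; have cs0 : c s != 0 by near: s.
  split; first exact: enorm_normalize.
  have : pt (c s) = pt x by near: s.
  by rewrite [RHS]radial_ext_unit.
- have dn : differentiable (@normalize R n) (c 0).
    by rewrite c0; exact/differentiable_normalize/regular_neq0.
  have := is_derive_comp dc dn.
  by rewrite c0 derive_normalize_tangent.
Unshelve. all: by end_near. Qed.

(** The velocity is a unit vector orthogonal to g s and to all directions
    tangent to the leaf, which leaves only the normal line. *)
Lemma normal_geodesic_velocity (g : R -> 'rV[R]_n) (s : R) :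
  normal_geodesic d M g -> regular (g s) ->
  derive1 g s = nu (g s) \/ derive1 g s = - nu (g s).
Proof.
move=> [geo norm_g] rg; have [A [B AB]] := geodesic_great_circle geo.
have [u1 v1 _] := geo.2 s.
have gg' : dot (derive1 g s) (g s) = 0.
  have [dg _ _] := AB s.
  have [_] := is_derive_dot dg dg.
  have -> : (fun y : R => dot (g y) (g y)) = cst 1.
    by apply/funext => t; have [ut _ _] := geo.2 t; rewrite (unit_dot ut).
  rewrite derive_cst [dot (g s) _]dotC; lra.
have [t [pt_t Mt]] : exists t, param_interval d t /\ M t = level_set p (p (g s)).
  apply: hS; exact: (isopol_range hp).
have plane : in_normal_plane (g s) (derive1 g s).
  move=> w wx wn; apply: (norm_g _ t) => //; rewrite Mt; first by split.
  exact: level_tangent.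
have := in_normal_planeP rg plane.
rewrite gg' mul0r scale0r add0r; set k := dot _ _ => E.
have : k ^+ 2 = 1.
  have := unit_dot v1; rewrite E dotZl dotZr dot_unit_normal//.
  by rewrite mulr1 -expr2.
move/eqP; rewrite sqrf_eq1 => /orP[] /eqP k1; rewrite E k1 ?scale1r ?scaleN1r.
  by left.
by right.
Qed.

End RegularPoints.

(** * Hessian metrics *)

Lemma derive_near0 {R : realType} (f : R -> R) s df :
  (\forall t \near s, f t = 0) -> is_derive s (1 : R) f df -> df = 0.
Proof.
move=> f0 [_ <-].
have : \forall t \near s, f t = cst 0 t by [].
by move/near_eq_derive => ->; rewrite derive_cst.
Qed.

Section Energy.
Context {R : realType} {n : nat} (F : 'rV[R]_n -> R) (hF : minkowski_norm F).
Implicit Types (x y u v w : 'rV[R]_n).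

Lemma energyZ k x : 0 <= k -> energy F (k *: x) = k ^+ 2 * energy F x.
Proof. by move=> k0; rewrite /energy (mink_homog hF)// exprMn -mulrA. Qed.

Lemma energy_gt0 x : x != 0 -> 0 < energy F x.
Proof. by move=> x0; rewrite /energy divr_gt0// exprn_gt0// (mink_gt0 hF). Qed.

Lemma energyE : energy F = 2^-1 *: (F * F).
Proof. by apply/funext => y; rewrite /energy mulrC expr2. Qed.

Lemma energy_differentiable x : x != 0 -> differentiable (energy F) x.
Proof.
move=> x0; rewrite energyE; apply: differentiableZ.
by apply: differentiableM; exact: (smooth_on_differentiable (mink_smooth hF) x0).
Qed.

Lemma grad_energyE x : x != 0 -> grad (energy F) x = F x *: grad F x.
Proof.
move=> x0; have dF : differentiable F x.
  exact: (smooth_on_differentiable (mink_smooth hF) x0).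
apply/rowP => i; rewrite !mxE energyE.
have dFi := derivableP (v := delta_mx 0 i) (diff_derivable dF).
have [_ ->] := is_deriveZ (2^-1 : R) (is_deriveM dFi dFi).
rewrite /GRing.scale/=; set a := 'D_ _ _ _; set b := F x; by field.
Qed.

Lemma grad_energy_differentiable x : x != 0 ->
  differentiable (grad (energy F)) x.
Proof.
move=> x0.
apply: (@near_eq_differentiable _ _ _ (fun y => F y *: grad F y)).
  by apply: filterS (near_punctured x0) => y y0; rewrite grad_energyE.
apply: differentiable_scale.
  exact: (smooth_on_differentiable (mink_smooth hF) x0).
exact: (smooth_on_grad_differentiable (mink_smooth hF) x0).
Qed.

Lemma derive_energy x v : x != 0 -> 'D_v (energy F) x = dot (grad (energy F) x) v.
Proof. by move=> x0; rewrite dot_grad//; exact: energy_differentiable. Qed.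

Lemma hessian_metricE x u v : x != 0 ->
  hessian_metric F x u v = dot ('D_u (grad (energy F)) x) v.
Proof.
move=> x0; rewrite /hessian_metric.
have -> : 'D_u ('D_v (energy F)) x = 'D_u (fun y => dot (grad (energy F) y) v) x.
  apply: near_eq_derive; apply: filterS (near_punctured x0) => y y0.
  exact: derive_energy.
have dG := derivableP (v := u) (diff_derivable (grad_energy_differentiable x0)).
have [_ ->] := is_derive_dot dG (is_derive_cst v x u).
by rewrite dot0r addr0.
Qed.

(** Differentiate E (x + h x) = (1 + h)^2 E x at h = 0. *)
Lemma energy_euler x : x != 0 -> dot (grad (energy F) x) x = 2 * energy F x.
Proof.
move=> x0; rewrite -derive_energy//.
have dE : is_derive (x + (0 : R) *: x) x (energy F) ('D_x (energy F) x).
  by rewrite scale0r addr0; exact/derivableP/diff_derivable/energy_differentiable.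
have := iffLR (is_derive_line _ _ _ _ _) dE => -[_ <-].
pose e1 (h : R) := 1 + h.
have H1 : is_derive (0 : R) (1 : R) e1 1.
  have := is_deriveD (is_derive_cst (1 : R) (0 : R) (1 : R)) (is_derive_id (0 : R) (1 : R)).
  by rewrite add0r.
have [_ E] := is_deriveM (is_deriveM H1 H1) (is_derive_cst (energy F x) (0 : R) (1 : R)).
have : \forall h \near (0 : R),
    energy F (x + h *: x) = (e1 * e1 * cst (energy F x)) h.
  have : \forall h \near (0 : R), `|h| < 1 by exact: nbhs0_lt.
  apply: filterS => h; rewrite ltr_norml => /andP[h1 _].
  rewrite -[X in X + _]scale1r -scalerDl energyZ//; lra.
move/near_eq_derive => ->; rewrite E /GRing.scale/= /cst /e1.
rewrite !addr0 !mulr1 mulr0 add0r mulrC; congr (_ * _).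
Qed.

(** Differentiate Euler's identity <dE(y), y> = 2 E(y). *)
Lemma derive_grad_energy_radial x v : x != 0 ->
  dot ('D_v (grad (energy F)) x) x = dot (grad (energy F) x) v.
Proof.
move=> x0.
have dG := derivableP (v := v) (diff_derivable (grad_energy_differentiable x0)).
have [_] := is_derive_dot dG (is_derive_id x v).
have -> : 'D_v (fun y => dot (grad (energy F) y) (id y)) x =
    'D_v (2 *: energy F : _ -> R) x.
  apply: near_eq_derive; apply: filterS (near_punctured x0) => y y0.
  exact: energy_euler.
rewrite deriveZ; last exact/diff_derivable/energy_differentiable.
rewrite derive_energy// /GRing.scale/= ; lra.
Qed.

End Energy.

(** * Normal planes *)

Section NormalPlanes.
Context {R : realType} {n d : nat}.
Context (M : R -> set 'rV[R]_n) (p : 'rV[R]_n -> R).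
Context (hp : isoparametric_polynomial d p).
Context (hS : forall s : R, -1 <= s <= 1 ->
  exists t, param_interval d t /\ M t = level_set p s).
Context (hgeo : forall x, regular p x ->
  exists g s, normal_geodesic d M g /\ g s = normalize x).
Implicit Types (x y w u : 'rV[R]_n).

Local Notation pt := (radial_ext p).
Local Notation nu := (unit_normal p).

Lemma normal_geodesic_from (g : R -> 'rV[R]_n) s : normal_geodesic d M g ->
  forall h, g (s + h) = cos h *: g s + sin h *: derive1 g s /\
    derive1 g (s + h) = cos h *: derive1 g s - sin h *: g s.
Proof.
move=> [geo _] h; have [A [B AB]] := geodesic_great_circle geo.
have [_ -> ->] := AB (s + h); have [_ -> ->] := AB s.
rewrite sinD cosD.
by split; apply/rowP => i; rewrite !mxE; ring.
Qed.

(** Position and velocity of a great circle span the same plane at all times,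
    and at regular points the velocity is plus or minus nu. *)
Lemma in_normal_plane_geodesic (g : R -> 'rV[R]_n) s s' y :
  normal_geodesic d M g -> regular p (g s) -> regular p (g s') ->
  in_normal_plane p (g s) y -> in_normal_plane p (g s') y.
Proof.
move=> ng rs rs' H w wx wn.
have w' : dot w (derive1 g s') = 0.
  case: (normal_geodesic_velocity hp hS ng rs') => ->; rewrite ?dotNr wn ?oppr0//.
have [g1 g1'] := normal_geodesic_from s' ng (s - s').
rewrite addrC subrK in g1 g1'.
have a1 : dot w (g s) = 0 by rewrite g1 dotDr !dotZr wx w' !mulr0 addr0.
have a2 : dot w (derive1 g s) = 0.
  by rewrite g1' dotDr dotNr !dotZr wx w' !mulr0 subr0.
apply: (H _ a1).
case: (normal_geodesic_velocity hp hS ng rs) => E; rewrite E in a2; first exact: a2.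
by apply/eqP; rewrite -oppr_eq0 -dotNr a2.
Qed.

Lemma regular_normalize x : regular p x -> regular p (normalize x).
Proof.
move=> rx; apply/regularZ => //.
by rewrite invr_gt0 enorm_gt0 (regular_neq0 rx).
Qed.

Lemma in_normal_plane_normalize x y : x != 0 ->
  in_normal_plane p (normalize x) y <-> in_normal_plane p x y.
Proof.
by move=> x0; apply: (in_normal_planeZ hp) => //; rewrite invr_gt0 enorm_gt0.
Qed.

Lemma near_regular_comp {T : topologicalType} (f : T -> 'rV[R]_n) s :
  {for s, continuous f} -> regular p (f s) -> \forall t \near s, regular p (f t).
Proof. by move=> cf rf; apply: (near_comp cf); exact: (near_regular hp). Qed.

(** A field of vectors in the normal planes is differentiated, along a normal
    plane, within that plane: on the half line and on the normal great circle
    through a point the normal plane is constant. *)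
Lemma derive_in_normal_plane (f : 'rV[R]_n -> 'rV[R]_n) x u :
  regular p x -> differentiable f x ->
  (forall y, regular p y -> in_normal_plane p y (f y)) ->
  in_normal_plane p x u -> in_normal_plane p x ('D_u f x).
Proof.
move=> rx df Hf Hu w wx wn; have x0 := regular_neq0 rx.
have Dx : dot w ('D_x f x) = 0.
  have dx : is_derive (x + (0 : R) *: x) x f ('D_x f x).
    by rewrite scale0r addr0; exact/derivableP/diff_derivable.
  have dl := iffLR (is_derive_line _ _ _ _ _) dx.
  apply: (@derive_near0 R (fun h => dot w (f (x + h *: x))) 0); last first.
    have := is_derive_dot (is_derive_cst w (0 : R) (1 : R)) dl => H.
    by apply: is_derive_eq; rewrite dot0l add0r.
  have : \forall h \near (0 : R), `|h| < 1 by exact: nbhs0_lt.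
  apply: filterS => h; rewrite ltr_norml => /andP[h1 _].
  have h0 : 0 < 1 + h by lra.
  have E : x + h *: x = (1 + h) *: x by rewrite scalerDl scale1r.
  have rh : regular p (x + h *: x) by rewrite E; exact/regularZ.
  have := Hf _ rh; rewrite {1}E => /(in_normal_planeZ hp _ h0 x0); exact.
have Dn : dot w ('D_(nu x) f x) = 0.
  have [g [s [ng gs]]] := hgeo rx.
  have rg : regular p (g s) by rewrite gs; exact: regular_normalize.
  have e0 : 0 < enorm x by rewrite enorm_gt0.
  have [A [B AB]] := geodesic_great_circle ng.1.
  have [dg _ _] := AB s.
  have xE : enorm x *: g s = x by rewrite gs scale_normalize.
  have dc : is_derive s (1 : R) (fun t => enorm x *: g t) (enorm x *: derive1 g s).
    exact: (is_deriveZ (enorm x) dg).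
  have dfx : differentiable f (enorm x *: g s) by rewrite xE.
  have := is_derive_comp dc dfx; rewrite xE => dfc.
  have H0 : dot w ('D_(enorm x *: derive1 g s) f x) = 0.
    apply: (@derive_near0 R (fun t => dot w (f (enorm x *: g t))) s); last first.
      have := is_derive_dot (is_derive_cst w s (1 : R)) dfc => H.
      by apply: is_derive_eq; rewrite dot0l add0r.
    have cg : {for s, continuous g}.
      by apply: differentiable_continuous; apply/derivable1_diffP; case: dg.
    apply: filterS (near_regular_comp cg rg) => t rt.
    have rt' : regular p (enorm x *: g t) by apply/regularZ.
    have := Hf _ rt'.
    move/(in_normal_planeZ hp _ e0 (regular_neq0 rt)).
    move/(in_normal_plane_geodesic ng rt rg); rewrite gs.
    by move/(in_normal_plane_normalize _ x0); exact.
  have nuE : nu (g s) = nu x.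
    by rewrite gs (unit_normalZ hp)// invr_gt0.
  have deriveZ_dir k v : 'D_(k *: v) f x = k *: 'D_v f x.
    by rewrite deriveE// linearZ /= -deriveE.
  have H1 : dot w ('D_(derive1 g s) f x) = 0.
    apply: (mulfI (lt0r_neq0 e0)); rewrite mulr0 -[RHS]H0.
    by rewrite (deriveZ_dir (enorm x) (derive1 g s)) (dotZr (enorm x) w).
  move: (normal_geodesic_velocity hp hS ng rg) H1; rewrite nuE.
  move: (derive1 g s) (nu x) => v e [->//|->].
  by rewrite -scaleN1r deriveZ_dir (dotZr _ w) mulN1r => /eqP; rewrite oppr_eq0 => /eqP.
have comb a b v : dot w ('D_v f x) = 0 -> dot w ('D_(a *: x + b *: v) f x) = 0.
  move=> Dv; rewrite deriveE// linearD !linearZ /= -!deriveE//.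
  move: ('D_x f x) ('D_v f x) Dx Dv => y z wy wz.
  by rewrite !dotlin wy wz !mulr0 addr0.
by rewrite (in_normal_planeP hp rx Hu); exact: comb.
Qed.

Lemma induced_level (F : 'rV[R]_n -> R) x y : induced_by d M F ->
  enorm x = 1 -> enorm y = 1 -> p x = p y -> F x = F y.
Proof.
move=> iF x1 y1 pxy.
have [t [ht Mt]] := hS (isopol_range hp x1).
by apply: (iF t ht); rewrite Mt.
Qed.

Lemma energy_leaf (F : 'rV[R]_n -> R) x y : minkowski_norm F ->
  induced_by d M F -> x != 0 -> y != 0 -> pt x = pt y ->
  dot x x * energy F y = dot y y * energy F x.
Proof.
move=> hF iF x0 y0 pxy.
have E : F (normalize x) = F (normalize y).
  by apply: induced_level => //; exact: enorm_normalize.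
have polar z : energy F z = dot z z * energy F (normalize z).
  by rewrite -[in LHS](scale_normalize z) (energyZ hF) ?sqrtr_ge0// enorm_sqr.
by rewrite (polar x) (polar y) /energy E; ring.
Qed.

(** Along a curve in the cone over a leaf E is proportional to the squared
    length, whose derivative in a direction orthogonal to x is 0. *)
Lemma grad_energy_in_normal_plane (F : 'rV[R]_n -> R) x : minkowski_norm F ->
  induced_by d M F -> regular p x -> in_normal_plane p x (grad (energy F) x).
Proof.
move=> hF iF rx w wx wn; have x0 := regular_neq0 rx.
have [|c [c0 dc Hc]] := leaf_curve hp rx (w := w); first by rewrite dotC.
have dE : differentiable (energy F) (c 0) by rewrite c0; exact: energy_differentiable.
have H1 := is_derive_comp dc dE.
have H2 := is_deriveB (is_deriveZ (dot x x) H1)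
  (is_deriveM (is_derive_dot dc dc) (is_derive_cst (energy F x) (0 : R) (1 : R))).
have := derive_near0 _ H2.
rewrite c0 derive_energy// dotC wx /GRing.scale/= /cst [dot x w]dotC wx addr0.
rewrite !mulr0 addr0 subr0 => H.
have {}H : dot x x * dot w (grad (energy F) x) = 0.
  apply: H.
  have cne : \forall s \near (0 : R), c s != 0.
    apply: (near_comp (P := fun y => is_true (y != 0)) (is_derive_continuous0 dc)).
    by rewrite c0; exact: near_punctured.
  near=> s.
  have cs0 : c s != 0 by near: s.
  have pcs : pt (c s) = pt x by near: s.
  rewrite -[LHS]/(dot x x * energy F (c s) - dot (c s) (c s) * energy F x).
  by rewrite (energy_leaf hF iF x0 cs0 (esym pcs)) subrr.
by move/eqP: H; rewrite mulf_eq0 dot_eq0 (negbTE x0) => /eqP.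
Unshelve. all: by end_near. Qed.

End NormalPlanes.

(** * Focal points on a normal circle *)

Lemma circle_angle {R : realType} (a b : R) : a ^+ 2 + b ^+ 2 = 1 ->
  exists t, cos t = a /\ sin t = b.
Proof.
move=> ab; have a1 : -1 <= a <= 1.
  have := sqr_ge0 b; have := sqr_ge0 (a - 1); have := sqr_ge0 (a + 1); nra.
have sq : Num.sqrt (1 - a ^+ 2) = `|b| by rewrite -ab addrAC subrr add0r sqrtr_sqr.
have [b0|b0] := leP 0 b.
  by exists (acos a); rewrite acosK// sin_acos// sq ger0_norm.
by exists (- acos a); rewrite cosN sinN acosK// sin_acos// sq ltr0_norm// opprK.
Qed.

Section FocalFreeArcs.
Context {R : realType} {n d : nat}.
Context (M : R -> set 'rV[R]_n) (p : 'rV[R]_n -> R).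
Context (hp : isoparametric_polynomial d p).
Context (hS : forall s : R, -1 <= s <= 1 ->
  exists t, param_interval d t /\ M t = level_set p s).
Context (hgeo : forall x, regular p x ->
  exists g s, normal_geodesic d M g /\ g s = normalize x).
Implicit Types (x y w u xi : 'rV[R]_n) (g : R -> 'rV[R]_n).

Local Notation nu := (unit_normal p).

(** The normal great circle through y reaches the displaced point, and its
    velocity there is normal to the leaf of that point. *)
Lemma unit_normal_circle y t : regular p y ->
  regular p (cos t *: normalize y + sin t *: nu y) ->
  exists m, nu (cos t *: normalize y + sin t *: nu y) =
            m *: (cos t *: nu y - sin t *: normalize y).
Proof.
move=> ry rf; have y0 := regular_neq0 ry.
have [g [s [ng gs]]] := hgeo ry.
have rg : regular p (g s) by rewrite gs; exact: regular_normalize.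
have nuE : nu (g s) = nu y by rewrite gs (unit_normalZ hp)// invr_gt0 enorm_gt0.
case: (normal_geodesic_velocity hp hS ng rg); rewrite nuE => vE.
- have [g1 g1'] := normal_geodesic_from s ng t.
  rewrite vE gs in g1 g1'; rewrite -g1 in rf *.
  case: (normal_geodesic_velocity hp hS ng rf) => E; rewrite -g1' E.
    by exists 1; rewrite scale1r.
  by exists (-1); rewrite scaleN1r opprK.
- have [g1 g1'] := normal_geodesic_from s ng (- t).
  rewrite vE gs cosN sinN scaleNr scalerN opprK in g1.
  rewrite vE gs cosN sinN scalerN scaleNr opprK [RHS]addrC in g1'.
  rewrite -g1 in rf *; rewrite -[cos t *: nu y - _]opprB -g1'.
  case: (normal_geodesic_velocity hp hS ng rf) => E; rewrite E.
    by exists (-1); rewrite scaleN1r opprK.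
  by exists 1; rewrite scale1r opprK.
Qed.

(** At a point of norm r this k is the principal curvature at x / r divided
    by r. *)
Definition curvature_direction x w (k : R) :=
  [/\ w != 0, dot w x = 0, dot w (nu x) = 0 & 'D_w nu x = - k *: w].

(** The displacement f y = cos t y + sin t nu(y) of unit vectors has derivative
    (cos t - k sin t) w in the direction w.  If this is 0 then the unit normal at
    f y is stationary as well; but up to sign that normal is
    cos t nu(y) - sin t y, with derivative - (k cos t + sin t) w.  The two factors
    cannot vanish together. *)
Lemma parallel_displacement_regular x w k t : enorm x = 1 -> regular p x ->
  curvature_direction x w k -> regular p (cos t *: x + sin t *: nu x) ->
  cos t - k * sin t != 0.
Proof.
move=> x1 rx [w0 wx wn dnu] rf; apply/eqP => k0.
have x0 := regular_neq0 rx.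
pose f y := cos t *: normalize y + sin t *: nu y.
pose N y := cos t *: nu y - sin t *: normalize y.
have dn : is_derive x w (@normalize R n) w.
  rewrite -[X in is_derive _ _ _ X](derive_normalize_tangent x1 wx).
  exact/derivableP/diff_derivable/differentiable_normalize.
have dv : is_derive x w nu (- k *: w).
  rewrite -dnu; apply/derivableP/diff_derivable.
  exact: (unit_normal_differentiable hp).
have df : is_derive x w f 0.
  have := is_deriveD (is_deriveZ (cos t) dn) (is_deriveZ (sin t) dv) => H.
  apply: is_derive_eq.
  by rewrite scalerA -scalerDl mulrN mulrC k0 scale0r.
have dN : is_derive x w N ((- (k * cos t) - sin t) *: w).
  have := is_deriveB (is_deriveZ (cos t) dv) (is_deriveZ (sin t) dn) => H.
  apply: is_derive_eq.
  by rewrite scalerA -scalerBl mulrN [k * _]mulrC.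
have fx : f x = cos t *: x + sin t *: nu x by rewrite /f normalize_unit.
have rfx : regular p (f x) by rewrite fx.
have dnuf : is_derive x w (fun y => nu (f y)) 0.
  have := is_derive_comp df (unit_normal_differentiable hp rfx).
  by rewrite derive0.
pose m y := dot (nu (f y)) (N y).
have [dm Dm] : derivable m x w /\ True.
  by split=> //; have [] := is_derive_dot dnuf dN.
have NN y : regular p y -> dot (N y) (N y) = 1.
  move=> ry; have y0 := regular_neq0 ry.
  have := unit_normal_radial hp (x := normalize y).
  rewrite normalize_neq0// => /(_ isT).
  rewrite (unit_normalZ hp) ?invr_gt0 ?enorm_gt0//.
  have := dot_unit_normal hp ry; have := unit_dot (enorm_normalize y0).
  rewrite /N; move: (nu y) (normalize y) => a b bb aa ab.
  have := cos2Dsin2 t; rewrite !dotlin aa bb [dot b a]dotC ab !mulr0 !mulr1 => <-.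
  ring.
have nuE y : regular p y -> regular p (f y) -> nu (f y) = m y *: N y.
  move=> ry rfy; have [c cE] := unit_normal_circle ry rfy.
  have {}cE : nu (f y) = c *: N y by [].
  by rewrite /m cE dotZl NN// mulr1.
have mx0 : m x != 0.
  apply/eqP => mx; have := dot_unit_normal hp rfx.
  by rewrite (nuE x rx rfx) mx scale0r dot0l => /esym/eqP; rewrite oner_eq0.
have cf : {for x, continuous f}.
  apply: differentiable_continuous; apply: differentiableD; apply: differentiableZ.
    exact: differentiable_normalize.
  exact: (unit_normal_differentiable hp).
have nearE : \forall y \near x, dot (nu (f y)) w = (m * (fun y => dot (N y) w)) y.
  near=> y.
  have ry : regular p y by near: y; exact: (near_regular hp).
  have rfy : regular p (f y) by near: y; exact: (near_regular_comp hp cf).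
  by rewrite {1}nuE// dotZl.
have [_ E1] := is_derive_dot dnuf (is_derive_cst w x w).
have E0 : dot 0 w + dot (nu (f x)) 0 = 0 by rewrite (dot0l w) (dot0r (nu (f x))) addr0.
rewrite E0 in E1.
have [_ E2] := is_deriveM (derivableP dm) (is_derive_dot dN (is_derive_cst w x w)).
have Nw : dot (N x) w = 0.
  rewrite /N normalize_unit// dotDl dotNl dotZl [X in _ - X]dotZl.
  by rewrite [dot (nu x) w]dotC wn [dot x w]dotC wx !mulr0 subrr.
move: E2; rewrite -(near_eq_derive _ nearE) E1.
rewrite dot0r addr0 Nw scale0r addr0 dotZl /GRing.scale/= => /esym/eqP.
rewrite !mulf_eq0 (negbTE mx0) dot_eq0 (negbTE w0) orbF => /eqP kt.
have := cos2Dsin2 t.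
have s0 : sin t * (1 + k ^+ 2) = 0 by move: k0 kt; nra.
have {}s0 : sin t = 0.
  move/eqP: s0; rewrite mulf_eq0 => /orP[/eqP//|/eqP k2].
  by have := sqr_ge0 k; nra.
have c0 : cos t = 0 by move: k0; rewrite s0; lra.
by rewrite s0 c0 expr0n/= addr0 => /esym/eqP; rewrite oner_eq0.
Unshelve. all: by end_near. Qed.

Lemma curvature_directionZ e x w k : 0 < e -> regular p x ->
  curvature_direction x w k -> curvature_direction (e *: x) w (k / e).
Proof.
move=> e0 rx [w0 wx wn dnu]; have x0 := regular_neq0 rx.
have [|||_ E] := @derive_homogeneous R n _ nu e 1 x w.
- by rewrite gt_eqF.
- move=> v; rewrite scale1r.
  have [->|v0] := eqVneq v 0; first by rewrite scaler0.
  exact: (unit_normalZ hp).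
- exact: (unit_normal_differentiable hp).
split=> //; [by rewrite dotZr wx mulr0|by rewrite (unit_normalZ hp e0 x0)|].
by rewrite E dnu div1r scalerA mulrN mulrC.
Qed.

Definition regular_arc x xi := exists g a b,
  [/\ normal_geodesic d M g, a <= b, g a = normalize x, g b = xi &
      forall s, a <= s <= b -> regular p (g s)].

Lemma regular_arc_plane x xi y : x != 0 -> regular_arc x xi ->
  in_normal_plane p x y <-> in_normal_plane p xi y.
Proof.
move=> x0 [g [a [b [ng ab ga gb rg]]]].
have ra : regular p (g a) by apply: rg; rewrite lexx.
have rb : regular p (g b) by apply: rg; rewrite lexx andbT.
rewrite -(in_normal_plane_normalize hp y x0) -ga -gb.
split; [exact: (in_normal_plane_geodesic hp hS ng ra rb)|exact: (in_normal_plane_geodesic hp hS ng rb ra)].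
Qed.

(** <y, x> - k <y, nu x> is the displacement factor at the point y of the normal
    circle of x; it is continuous and has no zero on the arc. *)
Lemma regular_arc_sign x w k z xi : enorm x = 1 -> regular p x ->
  curvature_direction x w k ->
  z != 0 -> regular_arc z xi -> (forall y, in_normal_plane p z y -> in_normal_plane p x y) ->
  0 < (dot (normalize z) x - k * dot (normalize z) (nu x)) *
      (dot xi x - k * dot xi (nu x)).
Proof.
move=> x1 rx cw z0 [g [a [b [ng ab ga gb rg]]]] plane.
pose l y := dot y x - k * dot y (nu x).
rewrite -ga -gb -/(l (g a)) -/(l (g b)).
have ra : regular p (g a) by apply: rg; rewrite lexx.
have l0 s : a <= s <= b -> l (g s) != 0.
  move=> sab; have rs := rg _ sab.
  have ps : in_normal_plane p x (g s).
    apply: plane; apply/(in_normal_plane_normalize hp _ z0); rewrite -ga.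
    exact: (in_normal_plane_geodesic hp hS ng rs ra (@in_normal_plane_self _ _ _ _)).
  have := in_normal_planeP hp rx ps; rewrite (unit_dot x1) divr1 => gE.
  have [us _ _] := ng.1.2 s.
  have [t [ct st]] : exists t, cos t = dot (g s) x /\ sin t = dot (g s) (nu x).
    apply: circle_angle.
    have := unit_dot us; have := unit_normal_radial hp (regular_neq0 rx).
    have := dot_unit_normal hp rx; have := unit_dot x1.
    rewrite [in dot (g s) (g s)]gE.
    move: (dot (g s) x) (dot (g s) (nu x)) (nu x) => c e v xx vv vx.
    rewrite !dotlin xx vv [dot x v]dotC vx => <-; ring.
  rewrite /l -ct -st; apply: (parallel_displacement_regular x1 rx cw).
  by rewrite ct st -gE.
have [A [B AB]] := geodesic_great_circle ng.1.
have cl : {within `[a, b], continuous (fun s => l (g s))}.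
  apply: derivable_within_continuous => s _.
  have [dg _ _] := AB s.
  have := is_deriveB (is_derive_dot dg (is_derive_cst x s (1 : R)))
    (is_deriveM (is_derive_cst k s (1 : R)) (is_derive_dot dg (is_derive_cst (nu x) s (1 : R)))).
  by case.
rewrite ltNge; apply/negP => neg.
have [|c] := IVT (v := 0) ab cl.
  rewrite ge_min le_max; move: neg.
  have [h1|h1] := leP (l (g a)) 0; have [h2|h2] := leP 0 (l (g b)) => //=; rewrite ?orbT//=; nra.
by rewrite in_itv/= => /l0/eqP.
Qed.

(** The displacement factor is positive at the end of a focal-free path that
    runs from x to xi and then to y inside one normal plane. *)
Lemma same_foot_sign x w k y xi : regular p x -> curvature_direction x w k ->
  y != 0 -> regular_arc x xi -> regular_arc y xi ->
  0 < dot y x / dot x x - k * dot y (nu x).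
Proof.
move=> rx cw y0 ax ay; have x0 := regular_neq0 rx.
pose z := normalize x; pose e := enorm x.
have e0 : 0 < e by rewrite enorm_gt0.
have xE : x = e *: z by rewrite scale_normalize.
have z1 : enorm z = 1 by exact: enorm_normalize.
have rz : regular p z by exact: regular_normalize.
have nuz : nu z = nu x by rewrite [in RHS]xE (unit_normalZ hp e0 (unit_neq0 z1)).
have cz : curvature_direction z w (e * k).
  rewrite mulrC -[X in k * X]invrK; apply: curvature_directionZ => //.
  by rewrite invr_gt0.
have plane v : in_normal_plane p y v -> in_normal_plane p z v.
  move=> H; apply/(in_normal_plane_normalize hp _ x0).
  by apply/(regular_arc_plane _ x0 ax)/(regular_arc_plane _ y0 ay).
have sy := regular_arc_sign z1 rz cz y0 ay plane.
have [g [a [b [ng ab ga gb rg]]]] := ax.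
have az : regular_arc z xi.
  by exists g, a, b; split=> //; rewrite ga (normalize_unit z1).
have sx : 0 < (1 : R) * (dot xi z - (e * k) * dot xi (nu z)).
  have := regular_arc_sign z1 rz cz (unit_neq0 z1) az (fun v => id).
  rewrite [normalize z]normalize_unit// (unit_dot z1).
  by rewrite [dot z (nu z)]dotC (unit_normal_radial hp (unit_neq0 z1)) mulr0 subr0.
rewrite mul1r in sx.
have {}sy := etrans (esym (pmulr_lgt0 _ sx)) sy.
have ey : 0 < enorm y by rewrite enorm_gt0.
have -> : dot y x / dot x x - k * dot y (nu x) =
    enorm y / e * (dot (normalize y) z - e * k * dot (normalize y) (nu z)).
  rewrite nuz; have -> : dot y x = enorm y * e * dot (normalize y) z.
    by rewrite [in LHS]xE dotZr -[in LHS](scale_normalize y) dotZl; ring.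
  have -> : dot y (nu x) = enorm y * dot (normalize y) (nu x).
    by rewrite -[in LHS](scale_normalize y) dotZl.
  rewrite -enorm_sqr -/e; field.
  by rewrite gt_eqF.
by rewrite mulr_gt0// divr_gt0.
Qed.

End FocalFreeArcs.

(** * The pointwise alternative *)

(** Both sides are polynomials of degree at most 2 in k, so that three common
    values force equal coefficients. *)
Lemma quadratic_factors {R : realType} (rho sg al be rh' sg' : R) (ks : seq R) :
  uniq ks -> (2 < size ks)%N ->
  (forall k, k \in ks -> rho - k * sg = (al - k * be) * (rh' - k * sg')) ->
  [/\ rho = al * rh', sg = be * rh' + al * sg' & be * sg' = 0].
Proof.
case: ks => [|a [|b [|c ks]]]//= uks _ H.
have := H a; have := H b; have := H c.
rewrite !inE !eqxx !orbT => /(_ isT) Hc /(_ isT) Hb /(_ isT) Ha.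
move: uks; rewrite !inE !negb_or -!andbA => /and5P[ab ac _ bc _].
have d1 : (a - b) * (- sg + (al * sg' + be * rh') - (a + b) * (be * sg')) = 0.
  by move: Ha Hb; nra.
have d2 : (a - c) * (- sg + (al * sg' + be * rh') - (a + c) * (be * sg')) = 0.
  by move: Ha Hc; nra.
have e1 : - sg + (al * sg' + be * rh') - (a + b) * (be * sg') = 0.
  by move/eqP: d1; rewrite mulf_eq0 subr_eq0 (negbTE ab) => /eqP.
have e2 : - sg + (al * sg' + be * rh') - (a + c) * (be * sg') = 0.
  by move/eqP: d2; rewrite mulf_eq0 subr_eq0 (negbTE ac) => /eqP.
have e3 : (b - c) * (be * sg') = 0 by move: e1 e2; nra.
have e4 : be * sg' = 0.
  by move/eqP: e3; rewrite mulf_eq0 subr_eq0 (negbTE bc) => /eqP.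
have e5 : sg = be * rh' + al * sg' by move: e1; rewrite e4; lra.
split=> //.
have : rho = al * rh' + a * (sg - (be * rh' + al * sg')) + a ^+ 2 * (be * sg').
  by move: Ha; lra.
by rewrite e4 e5 subrr !mulr0 !addr0.
Qed.

Section PointwiseDichotomy.
Context {R : realType} {n d : nat}.
Context (M : R -> set 'rV[R]_n) (p : 'rV[R]_n -> R).
Context (hp : isoparametric_polynomial d p).
Context (hS : forall s : R, -1 <= s <= 1 ->
  exists t, param_interval d t /\ M t = level_set p s).
Context (F1 F2 : 'rV[R]_n -> R) (Phi : 'rV[R]_n -> 'rV[R]_n).
Context (hd : (2 < d)%N) (hF1 : minkowski_norm F1) (hF2 : minkowski_norm F2).
Context (i1 : induced_by d M F1) (i2 : induced_by d M F2).
Context (hiso : hessian_isometry F1 F2 Phi).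
Context (hPhi : forall x, regular p x -> regular p (Phi x) /\
  exists xi, regular_arc M p (d := d) x xi /\ regular_arc M p (d := d) (Phi x) xi).
Implicit Types (x y w u z : 'rV[R]_n).

Local Notation nu := (unit_normal p).
Local Notation G1 := (grad (energy F1)).
Local Notation G2 := (grad (energy F2)).

Lemma geodesic_through x : regular p x ->
  exists g s, normal_geodesic d M g /\ g s = normalize x.
Proof. by move=> /hPhi[_ [xi [[g [a [b [ng _ ga _ _]]]] _]]]; exists g, a. Qed.

Let hgeo := geodesic_through.

Lemma Phi_differentiable x : x != 0 -> differentiable Phi x.
Proof.
by have [[Psi [sP _ _ _]] _] := hiso; exact: smooth_on_map_differentiable.
Qed.

Lemma Phi_neq0 x : x != 0 -> Phi x != 0.
Proof. by have [[Psi [_ _ H _]] _] := hiso => /H[]. Qed.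

(** Both normal planes are the normal plane at the common foot xi. *)
Lemma Phi_plane x y : regular p x ->
  in_normal_plane p x y <-> in_normal_plane p (Phi x) y.
Proof.
move=> rx; have [rP [xi [a1 a2]]] := hPhi rx.
rewrite (regular_arc_plane hp hS y (regular_neq0 rx) a1).
by rewrite (regular_arc_plane hp hS y (regular_neq0 rP) a2).
Qed.

Lemma Phi_in_plane x : regular p x -> in_normal_plane p x (Phi x).
Proof. by move=> rx; apply/(Phi_plane _ rx); exact: in_normal_plane_self. Qed.

Lemma dPhi_injective x u : x != 0 -> 'D_u Phi x = 0 -> u = 0.
Proof.
move=> x0 du; apply/eqP/contraT => u0.
have [_ iso] := hiso; have := mink_hessian hF1 x0 u0.
rewrite -iso// du hessian_metricE ?Phi_neq0//.
by rewrite dot0r ltxx.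
Qed.

Lemma dPhi_in_plane x u : regular p x -> in_normal_plane p x u ->
  in_normal_plane p x ('D_u Phi x).
Proof.
move=> rx; have dP := Phi_differentiable (regular_neq0 rx).
exact: (derive_in_normal_plane hp hS hgeo rx dP Phi_in_plane).
Qed.

(** An isometry has an injective differential, and the differential of Phi maps
    the normal plane to itself; the preimage is given by Cramer's rule. *)
Lemma dPhi_onto_plane x z : regular p x -> in_normal_plane p x z ->
  exists2 u, in_normal_plane p x u & 'D_u Phi x = z.
Proof.
move=> rx pz; have x0 := regular_neq0 rx.
have dP := Phi_differentiable x0.
have px := dPhi_in_plane rx (@in_normal_plane_self _ _ _ _).
have pn : in_normal_plane p x (nu x) by move=> w _.
have {}pn := dPhi_in_plane rx pn.
have coords y : in_normal_plane p x y -> exists a b, y = a *: x + b *: nu x.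
  by move=> /(in_normal_planeP hp rx) yE; eexists; eexists; exact: yE.
have [a1 [b1 xE]] := coords _ px; have [a2 [b2 nE]] := coords _ pn.
have [c1 [c2 zE]] := coords _ pz.
have DE s t : 'D_(s *: x + t *: nu x) Phi x =
    (s * a1 + t * a2) *: x + (s * b1 + t * b2) *: nu x.
  move: nE; move: (nu x) xE => v xE vE.
  rewrite deriveE// linearD !linearZ /= -!deriveE// xE vE.
  by apply/rowP => i; rewrite !mxE; ring.
have lin0 s t : s *: x + t *: nu x = 0 -> s = 0 /\ t = 0.
  move=> E; have nn := dot_unit_normal hp rx; have nx := unit_normal_radial hp x0.
  move: (nu x) E nn nx => v E nn nx.
  have := congr1 (dot ^~ x) E; have := congr1 (dot ^~ v) E.
  rewrite !dotlin nn nx [dot x v]dotC nx !mulr0 add0r addr0 mulr1 => -> /eqP.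
  by rewrite mulf_eq0 dot_eq0 (negbTE x0) orbF => /eqP.
have inj s t : s * a1 + t * a2 = 0 -> s * b1 + t * b2 = 0 -> s = 0 /\ t = 0.
  move=> E1 E2; apply: lin0; apply: (dPhi_injective x0).
  by rewrite DE E1 E2 !scale0r addr0.
have det0 : a1 * b2 - a2 * b1 != 0.
  apply/eqP => D.
  have [b20 b10] : b2 = 0 /\ - b1 = 0 by apply: inj; move: D; lra.
  have [a20 a10] : a2 = 0 /\ - a1 = 0 by apply: inj; move: D; lra.
  have [/eqP] : 1 = 0 :> R /\ 0 = 0 :> R.
    by apply: inj; [move: a10|move: b10]; lra.
  by rewrite oner_eq0.
exists (((c1 * b2 - c2 * a2) / (a1 * b2 - a2 * b1)) *: x +
        ((a1 * c2 - b1 * c1) / (a1 * b2 - a2 * b1)) *: nu x).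
  exact: in_normal_plane_lin.
by rewrite DE zE; congr (_ *: _ + _ *: _); field.
Qed.

(** The gradient of E is a field in the normal planes, and so is its derivative
    along a normal plane; hence that derivative is orthogonal to w. *)
Lemma hessian_mixed (F : 'rV[R]_n -> R) x u w : minkowski_norm F ->
  induced_by d M F -> regular p x -> in_normal_plane p x u ->
  dot w x = 0 -> dot w (nu x) = 0 -> hessian_metric F x u w = 0.
Proof.
move=> hF iF rx pu wx wn; have x0 := regular_neq0 rx.
rewrite hessian_metricE// dotC.
have dG := grad_energy_differentiable hF x0.
have pG y : regular p y -> in_normal_plane p y (grad (energy F) y).
  exact: (grad_energy_in_normal_plane hp hS).
exact: (derive_in_normal_plane hp hS hgeo rx dG pG pu).
Qed.

(** Write f = a x + b nu.  Modulo the normal plane, D_w f is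
    a w + b D_w nu = (a - k b) w. *)
Lemma derive_plane_field (f : 'rV[R]_n -> 'rV[R]_n) x w k : regular p x ->
  differentiable f x -> (forall y, regular p y -> in_normal_plane p y (f y)) ->
  curvature_direction p x w k ->
  in_normal_plane p x ('D_w f x -
     (dot (f x) x / dot x x - k * dot (f x) (nu x)) *: w).
Proof.
move=> rx df Hf [w0 wx wn dnu]; have x0 := regular_neq0 rx.
have dn := unit_normal_differentiable hp rx.
pose a y := dot (f y) y / dot y y; pose b y := dot (f y) (nu y).
have da : differentiable a x.
  apply: differentiableM; first exact: differentiable_dot.
  by apply: differentiableV; [exact: differentiable_dot|rewrite dot_eq0].
have db : differentiable b x by exact: differentiable_dot.
have fE : 'D_w f x = 'D_w (fun y => a y *: y + b y *: nu y) x.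
  apply: near_eq_derive; apply: filterS (near_regular hp rx) => y ry.
  exact: (in_normal_planeP hp ry (Hf y ry)).
have dw (g : 'rV[R]_n -> R) : differentiable g x -> is_derive x w g ('D_w g x).
  by move=> dg; exact/derivableP/diff_derivable.
have dnuw : is_derive x w nu (- k *: w).
  by rewrite -dnu; exact/derivableP/diff_derivable.
have [_ E] := is_deriveD (is_derive_scale (dw _ da) (is_derive_id x w))
  (is_derive_scale (dw _ db) dnuw).
rewrite fE [X in in_normal_plane _ _ (X - _)]E -/(a x) -/(b x).
rewrite (_ : _ - _ = 'D_w a x *: x + 'D_w b x *: nu x).
  exact: in_normal_plane_lin.
by apply/rowP => i; rewrite !mxE; ring.
Qed.

Lemma plane_orthogonal x y w : in_normal_plane p x y -> dot w x = 0 ->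
  dot w (nu x) = 0 -> dot y w = 0.
Proof. by move=> H wx wn; rewrite dotC; exact: H. Qed.

(** Let z be the component of D_w Phi in the normal plane.  Since z = D_u Phi for
    some u in that plane and Phi is an isometry, z is Hessian orthogonal to
    D_w Phi, and to w by hessian_mixed, hence to itself; so z = 0 and
    D_w Phi = (a - k b) w.  The equation is the isometry condition on w, with the
    Hessian of F2 computed from the field dE2 o Phi. *)
Lemma curvature_equation x w k : regular p x -> curvature_direction p x w k ->
  let a := dot (Phi x) x / dot x x in let b := dot (Phi x) (nu x) in
  let a' := dot (G2 (Phi x)) x / dot x x in let b' := dot (G2 (Phi x)) (nu x) in
  let r := dot (G1 x) x / dot x x in let s := dot (G1 x) (nu x) in
  [/\ r - k * s = (a - k * b) * (a' - k * b'), 0 < a - k * b & 0 < r - k * s].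
Proof.
move=> rx cw a b a' b' r s; have x0 := regular_neq0 rx.
have [w0 wx wn dnu] := cw; have [_ iso] := hiso.
have [ry [xi [arc1 arc2]]] := hPhi rx; have y0 := regular_neq0 ry.
have dP := Phi_differentiable x0.
have dG1 := grad_energy_differentiable hF1 x0.
have dG2 := grad_energy_differentiable hF2 y0.
have pG1 y : regular p y -> in_normal_plane p y (G1 y).
  exact: (grad_energy_in_normal_plane hp hS).
have pG2 y : regular p y -> in_normal_plane p y (G2 (Phi y)).
  move=> ry'; apply/(Phi_plane _ ry').
  by apply: (grad_energy_in_normal_plane hp hS) => //; case: (hPhi ry').
have wy : dot w (Phi x) = 0 by apply: (Phi_in_plane rx).
have wny : dot w (nu (Phi x)) = 0.
  by have /(Phi_plane _ rx) : in_normal_plane p (Phi x) (nu (Phi x)) by []; exact.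
have lam : 0 < a - k * b.
  by have := same_foot_sign hp hS hgeo rx cw y0 arc1 arc2; rewrite /a /b.
pose z := 'D_w Phi x - (a - k * b) *: w.
have pz : in_normal_plane p x z.
  exact: (derive_plane_field rx dP Phi_in_plane cw).
have dPw : 'D_w Phi x = (a - k * b) *: w + z by rewrite /z addrC subrK.
have z0 : z = 0.
  have [u pu du] := dPhi_onto_plane rx pz.
  have Hzw : hessian_metric F2 (Phi x) z w = 0.
    by apply: hessian_mixed => //; apply/(Phi_plane _ rx).
  have := hessian_mixed hF1 i1 rx pu wx wn; rewrite -iso// du dPw.
  move: Hzw; rewrite !hessian_metricE// dotDr dotZr => ->; rewrite mulr0 add0r.
  rewrite -hessian_metricE// => Hzz; apply/eqP/contraT => zn0.
  by have := mink_hessian hF2 y0 zn0; rewrite Hzz ltxx.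
rewrite z0 addr0 in dPw.
have ww : 0 < dot w w by rewrite dot_gt0.
have H1 : hessian_metric F1 x w w = (r - k * s) * dot w w.
  rewrite hessian_metricE//.
  have := plane_orthogonal (derive_plane_field rx dG1 pG1 cw) wx wn.
  by rewrite dotDl dotNl dotZl => /eqP; rewrite subr_eq0 => /eqP.
have dK : differentiable (G2 \o Phi) x by exact: differentiable_comp.
have DK : 'D_w (G2 \o Phi) x = (a - k * b) *: 'D_w G2 (Phi x).
  have [_ ->] := is_derive_comp (derivableP (v := w) (diff_derivable dP)) dG2.
  by rewrite dPw deriveE// linearZ /= -deriveE.
have H2 : (a - k * b) * dot ('D_w G2 (Phi x)) w = (a' - k * b') * dot w w.
  have := plane_orthogonal (derive_plane_field rx dK pG2 cw) wx wn.
  by rewrite DK dotDl dotNl !dotZl => /eqP; rewrite subr_eq0 => /eqP.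
have H3 : hessian_metric F1 x w w = (a - k * b) * ((a' - k * b') * dot w w).
  rewrite -iso// dPw hessian_metricE// dotZr -H2; congr (_ * _).
  by rewrite deriveE// linearZ /= -deriveE// dotZl.
split=> //.
  by apply: (mulIf (lt0r_neq0 ww)); rewrite -H1 H3 mulrA.
by rewrite -(pmulr_lgt0 _ ww) -H1; exact: (mink_hessian hF1).
Qed.

Lemma curvature_directions x : regular p x -> exists ks : seq R,
  [/\ uniq ks, (2 < size ks)%N & forall k, k \in ks -> exists w, curvature_direction p x w k].
Proof.
move=> rx; have x0 := regular_neq0 rx; have e0 : 0 < enorm x by rewrite enorm_gt0.
have rz := regular_normalize rx; have z1 := enorm_normalize x0.
have zx : enorm x *: normalize x = x by rewrite scale_normalize.
have [|ls [uls sls Hls]] := isopol_curvatures hp z1.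
  by have [_] := rz; rewrite radial_ext_unit.
exists [seq l / enorm x | l <- ls]; split.
- rewrite map_inj_uniq// => l l' /(congr1 ( *%R^~ (enorm x))).
  by rewrite !divfK ?gt_eqF.
- by rewrite size_map sls.
- move=> _ /mapP[l /Hls[w [w0 wz wn dw]] ->]; exists w; rewrite -[x in curvature_direction _ x]zx.
  by apply: (curvature_directionZ hp e0 rz); split.
Qed.

(** With b = <Phi x, nu x> and b' = <dE2(Phi x), nu x>, the curvature equations
    give b b' = 0.  The case b = 0 is the first alternative.  The case b' = 0 is the
    second one; there r - k s > 0 and a - k b > 0 make the factor positive. *)
Lemma pointwise_dichotomy x : regular p x -> exists c : R, 0 < c /\
  ((Phi x = c *: x /\ G2 (Phi x) = c^-1 *: G1 x) \/
   (Phi x = c *: G1 x /\ G2 (Phi x) = c^-1 *: x)).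
Proof.
move=> rx; have x0 := regular_neq0 rx.
have [ks [uks sks Hks]] := curvature_directions rx.
have [ry _] := hPhi rx.
have pP := in_normal_planeP hp rx (Phi_in_plane rx).
have pG1 := in_normal_planeP hp rx (grad_energy_in_normal_plane hp hS hF1 i1 rx).
have pG2 : in_normal_plane p x (G2 (Phi x)).
  by apply/(Phi_plane _ rx); exact: (grad_energy_in_normal_plane hp hS).
have {}pG2 := in_normal_planeP hp rx pG2.
have Hc k : k \in ks -> _ := fun kin => let: ex_intro w cw := Hks k kin in
  curvature_equation rx cw.
move: pP pG1 pG2 Hc => /=.
set a := dot (Phi x) x / _; set b := dot (Phi x) _.
set r := dot (G1 x) x / _; set s := dot (G1 x) _.
set a' := dot (G2 _) x / _; set b' := dot (G2 _) _ => pP pG1 pG2 Hc.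
have [|rE sE /eqP] := quadratic_factors (rho := r) (sg := s) (al := a) (be := b)
    (rh' := a') (sg' := b') uks sks.
  by move=> k /Hc[].
have [k kin] : exists k, k \in ks.
  by case: ks sks {uks Hks Hc} => // k ks _; exists k; rewrite inE eqxx.
have [E l1 l2] := Hc k kin.
have l3 : 0 < a' - k * b' by rewrite -(pmulr_rgt0 _ l1) -E.
rewrite mulf_eq0 => /orP[/eqP b0|/eqP b0].
- exists a; move: l1; rewrite b0 mulr0 subr0 => a0; split=> //; left.
  rewrite pP b0 scale0r addr0; split=> //.
  rewrite b0 scale0r addr0 in pP; rewrite -pP pG2 pG1 rE sE b0 mul0r add0r.
  by rewrite scalerDr !scalerA !mulKf// lt0r_neq0.
- move: l3; rewrite b0 mulr0 subr0 => a0.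
  exists a'^-1; rewrite invr_gt0; split=> //; right; split.
    rewrite pP pG1 rE sE b0 mulr0 addr0; move: (nu x) => v.
    by apply/rowP => i; rewrite !mxE; field; exact: lt0r_neq0.
  by rewrite pG2 b0 scale0r addr0 invrK.
Qed.

End PointwiseDichotomy.

(** * Locally constant functions on connected sets *)

Lemma connected_open_split {T : topologicalType} (C O1 O2 : set T) x :
  connected C -> open O1 -> open O2 -> C `<=` O1 `|` O2 ->
  (forall y, C y -> O1 y -> O2 y -> False) -> C x -> O1 x -> C `<=` O1.
Proof.
move=> cC o1 o2 cov dis Cx O1x.
suff -> : C = C `&` O1 by move=> y [].
apply/esym; apply: cC.
- by exists x.
- by exists O1.
- exists (~` O2); first exact: open_closedC.
  apply/seteqP; split=> y [Cy Oy]; split=> //; first exact: dis.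
  by case: (cov _ Cy).
Qed.

Lemma locally_constant_connected {R : realType} {n : nat} (f : 'rV[R]_n -> R)
    (O C : set 'rV[R]_n) x y :
  open O -> (forall z, O z -> forall v, is_derive z v f 0) ->
  connected C -> C `<=` O -> C x -> C y -> f x = f y.
Proof.
move=> oO df cC CO Cx Cy.
have loc z : O z -> \forall u \near z, O u /\ f u = f z.
  move=> Oz; have : \forall u \near z, O u by move: oO; rewrite openE; exact.
  move/nbhs_ballP => [e /= e0 He]; apply/nbhs_ballP; exists e => //= u zu.
  split; first exact: He.
  apply/eqP; rewrite -subr_eq0 -normr_le0.
  have := @increment_le R _ f z (u - z) 1 0; rewrite scale1r subrKC mul0r; apply.
  move=> s; rewrite normr1 => s1; have [|dv ->] := df (z + s *: (u - z)) _ (u - z).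
    apply: He; move: zu; rewrite -!ball_normE /ball_/= => zu.
    rewrite opprD addNKr normrN normrZ; apply: le_lt_trans zu.
    by rewrite [`|z - u|]distrC ler_piMl.
  by rewrite normr0.
apply/esym.
suff : C `<=` [set z | O z /\ f z = f x] by move=> /(_ y Cy)[].
apply: (@connected_open_split _ C _ [set z | O z /\ f z != f x] x) => //.
- rewrite openE => z [Oz fz]; apply: filterS (loc z Oz) => u [Ou fu].
  by split=> //; rewrite fu.
- rewrite openE => z [Oz fz]; apply: filterS (loc z Oz) => u [Ou fu].
  by split=> //; rewrite fu.
- move=> z Cz /=; have Oz := CO _ Cz.
  by have [E|E] := eqVneq (f z) (f x); [left|right].
- by move=> z _ /= [_ ->] [_ /eqP].
- by split=> //; exact: CO.
Qed.

(** * Density of the regular points *)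

Section HomogeneousPolynomial.
Context {R : realType} {n : nat}.
Implicit Types (P : mpoly.mpoly n R) (u v x : 'rV[R]_n).

Definition poly_at P x : R := mpoly.meval (fun i => x 0 i) P.

Definition line_coord u v i : {poly R} := (u 0 i)%:P + v 0 i *: 'X.

Lemma line_coordE u v i s : (line_coord u v i).[s] = (u + s *: v) 0 i.
Proof. by rewrite /line_coord !hornerE !mxE mulrC. Qed.

(** The restriction to a line is univariate, so that it vanishes identically as
    soon as it vanishes near one point. *)
Definition line_poly P u v : {poly R} :=
  \sum_(m <- mpoly.msupp P)
    (mpoly.mcoeff m P)%:P * \prod_i line_coord u v i ^+ (m i).

Lemma line_polyE P u v s : (line_poly P u v).[s] = poly_at P (u + s *: v).
Proof.
rewrite /line_poly /poly_at mpoly.mevalE horner_sum; apply: eq_bigr => m _.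
rewrite hornerM hornerC horner_prod; congr (_ * _); apply: eq_bigr => i _.
by rewrite horner_exp line_coordE.
Qed.

Definition line_dot u v : {poly R} := \sum_i line_coord u v i ^+ 2.

Lemma line_dotE u v s :
  (line_dot u v).[s] = dot (u + s *: v) (u + s *: v).
Proof.
rewrite /line_dot horner_sum dotE; apply: eq_bigr => i _.
by rewrite horner_exp line_coordE expr2.
Qed.

Lemma poly_atZ d P k x : P \is mpoly.ishomog1 d (mpoly.Measure.clone n mpoly.mdeg _) ->
  poly_at P (k *: x) = k ^+ d * poly_at P x.
Proof.
move=> /mpoly.dhomogP hP; rewrite /poly_at !mpoly.mevalE big_distrr/=.
rewrite big_seq [RHS]big_seq; apply: eq_bigr => m /hP dm.
have {}dm : mpoly.mdeg m = d by [].
rewrite mulrCA; congr (_ * _); rewrite -dm mpoly.mdegE -prodrXr -big_split/=.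
by apply: eq_bigr => i _; rewrite mxE exprMn.
Qed.

Lemma near0_poly_eq0 (h : {poly R}) (e : R) : 0 < e ->
  (forall s, `|s| < e -> h.[s] = 0) -> h = 0.
Proof.
move=> e0 H; apply/eqP/contraT => h0.
pose rs := [seq e / k.+2%:R | k <- iota 0 (size h)].
have := @max_poly_roots _ h rs h0; rewrite size_map size_iota ltnn; apply.
  apply/allP => _ /mapP[k _ ->]; apply/rootP/H.
  rewrite ger0_norm ?divr_ge0 ?(ltW e0)//.
  by rewrite ltr_pdivrMr// ltr_pMr// ltr1n.
rewrite map_inj_uniq ?iota_uniq// => k l /(mulfI (lt0r_neq0 e0)) /invr_inj /eqP.
by rewrite eqr_nat => /eqP[].
Qed.

(** P vanishes only at 0.  By the intermediate value theorem, the segment between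
    two points where P has opposite signs passes through 0, so that such points
    are proportional.  A vector off the line of u has the sign of u or of v, and
    then contradicts this for the other one. *)
Lemma poly_square_sign d P u v : (1 < n)%N -> (0 < d)%N ->
  (forall x, poly_at P x ^+ 2 = dot x x ^+ d) ->
  0 < poly_at P u -> 0 < - poly_at P v -> False.
Proof.
move=> n1 d0 H.
have P0 x : poly_at P x = 0 -> x = 0.
  move=> E; have := H x; rewrite E expr0n/= => /esym/eqP.
  by rewrite expf_eq0 d0 /= dot_eq0 => /eqP.
have seg a b : 0 < poly_at P a -> 0 < - poly_at P b ->
    exists s, a + s *: (b - a) = 0.
  move=> Pa Pb.
  have cp : {within `[0, 1], continuous (horner (line_poly P a (b - a)))}.
    by apply: continuous_subspaceT => s; exact: continuous_horner.
  have [|s _] := IVT (v := 0) ler01 cp.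
    rewrite !line_polyE scale0r addr0 scale1r subrKC.
    rewrite ge_min le_max; move: Pa Pb; rewrite oppr_gt0 => /ltW-> /ltW->.
    by rewrite orbT.
  by rewrite line_polyE => /P0; exists s.
move=> Pu Pv.
have nz x : poly_at P x != 0 -> x != 0.
  apply: contra_neq => ->; have := H 0.
  by rewrite dot0l expr0n gtn_eqF// => /eqP; rewrite sqrf_eq0 => /eqP.
have u0 : u != 0 by apply: nz; rewrite lt0r_neq0.
have v0 : v != 0 by apply: nz; rewrite -oppr_eq0 lt0r_neq0.
have [w wu] : exists w, forall c, w <> c *: u.
  have [i ui] : exists i, u 0 i != 0.
    apply/existsP; rewrite -negb_forall; apply: contra u0 => /forallP u0.
    by apply/eqP/rowP => i; rewrite mxE; exact/eqP.
  have [j ji] : exists j : 'I_n, j != i.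
    pose k : nat := if (i : nat) == 0%N then 1%N else 0%N.
    have kn : (k < n)%N by rewrite /k; case: ifP => // _; exact: ltnW.
    exists (Ordinal kn); rewrite -val_eqE /= /k.
    by case: ifP => [/eqP->//|/negbT]; rewrite eq_sym.
  exists (delta_mx 0 j) => c E.
  have := congr1 (fun z : 'rV[R]_n => z 0 i) E; rewrite /= !mxE eqxx eq_sym (negbTE ji) => /esym/eqP.
  rewrite mulf_eq0 (negbTE ui) orbF => /eqP c0.
  have := congr1 (fun z : 'rV[R]_n => z 0 j) E; rewrite /= !mxE !eqxx c0 mul0r => /eqP.
  by rewrite oner_eq0.
have prop (a b : 'rV[R]_n) : b != 0 -> (exists s, a + s *: (b - a) = 0) -> exists c, a = c *: b.
  move=> b0 [s E].
  have {}E : (1 - s) *: a = - s *: b.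
    apply/eqP; rewrite -subr_eq0; apply/eqP; rewrite -[RHS]E.
    by apply/rowP => i; rewrite !mxE; ring.
  have s1 : 1 - s != 0.
    apply/eqP => s1; move/eqP: E; rewrite s1 scale0r eq_sym scaler_eq0 (negbTE b0) orbF.
    by move=> /eqP; have := @ltr01 R; move: s1; lra.
  by exists ((1 - s)^-1 * - s); rewrite -scalerA -E scalerA mulVf// scale1r.
have wu0 : w != 0 by apply/eqP => w0; apply: (wu 0); rewrite scale0r.
have [Pw|Pw|Pw] := ltgtP (poly_at P w) 0.
- have [c uE] : exists c, u = c *: w.
    by apply: prop => //; apply: seg => //; rewrite oppr_gt0.
  have c0 : c != 0 by apply: contra_neq u0 => c0; rewrite uE c0 scale0r.
  by apply: (wu c^-1); rewrite uE scalerA mulVf// scale1r.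
- have [c wE] : exists c, w = c *: v by apply: prop => //; exact: seg.
  have [e uE] : exists c, u = c *: v by apply: prop => //; exact: seg.
  have e0 : e != 0 by apply: contra_neq u0 => c0; rewrite uE c0 scale0r.
  by apply: (wu (c / e)); rewrite wE uE scalerA divfK.
- by move/eqP: wu0; apply; exact: P0.
Qed.

End HomogeneousPolynomial.

Section RegularDense.
Context {R : realType} {n d : nat} (p : 'rV[R]_n -> R).
Context (n2 : (1 < n)%N) (d0 : (0 < d)%N) (hp : isoparametric_polynomial d p).

(** On an open set without regular points P^2 is the d-th power of the squared
    length.  This extends to the whole space along lines, whereas P takes both
    values 1 and - 1 on the sphere. *)
Lemma regular_dense : punctured `<=` closure (regular p).
Proof.
have [P [hP Pp]] := isopol_homog hp.
have PE x : x != 0 -> poly_at P x = enorm x ^+ d * radial_ext p x.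
  move=> x0; rewrite -[in LHS](scale_normalize x) (poly_atZ _ _ hP); congr (_ * _).
  by rewrite /radial_ext /= Pp// /usphere /= enorm_normalize.
move=> x x0; apply: contrapT => /existsNP[B /not_implyP[Bx Bn]].
have irr y : B y -> y != 0 -> radial_ext p y ^+ 2 = 1.
  move=> By y0; have /andP[p1 p2] := radial_ext_range hp y0.
  apply/eqP; rewrite sqrf_eq1; apply: contrapT => /negP; rewrite negb_or => /andP[q1 q2].
  apply: Bn; exists y; split=> //; split=> //.
  by rewrite !lt_neqAle p1 p2 q1 eq_sym q2.
have /nbhs_ballP[e /= e0 He] : \forall y \near x, B y /\ y != 0.
  by apply: filterI => //; exact: near_punctured.
have sq y : poly_at P y ^+ 2 = dot y y ^+ d.
  pose v := y - x.
  have h0 : line_poly P x v ^+ 2 - line_dot x v ^+ d = 0.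
    pose M := `|v| + 1; have M0 : 0 < M by rewrite ltr_pwDr.
    apply: (@near0_poly_eq0 _ _ (e / M)); first by rewrite divr_gt0.
    move=> s; rewrite ltr_pdivlMr// => sM.
    have [Bz z0] : B (x + s *: v) /\ x + s *: v != 0.
      apply: He; rewrite -ball_normE /ball_/= opprD addNKr normrN normrZ.
      by apply: le_lt_trans sM; rewrite ler_wpM2l// lerDl.
    rewrite hornerD hornerN !horner_exp line_polyE line_dotE PE// exprMn irr//.
    by rewrite mulr1 -exprM mulnC exprM enorm_sqr subrr.
  have := congr1 (horner^~ 1) h0.
  rewrite /= hornerD hornerN !horner_exp line_polyE line_dotE horner0 scale1r.
  by rewrite /v subrKC => /eqP; rewrite subr_eq0 => /eqP.
have [u [u1 pu _]] : critical_value p 1 by apply/(isopol_critical hp); left.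
have [v [v1 pv _]] : critical_value p (-1) by apply/(isopol_critical hp); right.
apply: (@poly_square_sign R n d P u v n2 d0 sq).
  by rewrite /poly_at -Pp// pu.
by rewrite /poly_at -Pp// pv opprK.
Qed.

End RegularDense.

(** * Leaves *)

Section Leaves.
Context {R : realType} {n d : nat}.
Context (M : R -> set 'rV[R]_n) (p : 'rV[R]_n -> R).
Context (hp : isoparametric_polynomial d p).
Context (hS : forall s : R, -1 <= s <= 1 ->
  exists t, param_interval d t /\ M t = level_set p s).
Implicit Types (x y z w : 'rV[R]_n).

Local Notation pt := (radial_ext p).
Local Notation nu := (unit_normal p).

Definition leaf_cone (s : R) : set 'rV[R]_n := [set x | x != 0 /\ pt x = s].

Lemma ray_connected y : connected [set k *: y | k in [set k : R | 0 < k]].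
Proof.
apply: connected_continuous_connected.
  apply/connected_intervalP => a b /= a0 b0 c /andP[ac cb].
  exact: lt_le_trans ac.
apply: continuous_subspaceT => k; apply: differentiable_continuous.
exact: differentiableZl.
Qed.

(** The cone is the union of the rays through a connected leaf, each of which
    meets the leaf. *)
Lemma leaf_cone_connected (s : R) : -1 < s < 1 -> connected (leaf_cone s).
Proof.
move=> s1; have cL := isopol_connected hp s1.
pose L := level_set p s.
pose A y := L `|` [set k *: y | k in [set k : R | 0 < k]].
have E : leaf_cone s = \bigcup_(y in L) A y.
  apply/seteqP; split=> [x [x0 px]|x [y [y1 py] [[x1 px]|[k /= k0 <-]]]].
  - exists (normalize x).
      by split; [exact: enorm_normalize|].
    right; exists (enorm x) => /=; first by rewrite enorm_gt0.
    exact: scale_normalize.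
  - by split; [exact: unit_neq0|rewrite radial_ext_unit].
  - split; first by rewrite scaler_eq0 negb_or gt_eqF//= unit_neq0.
    by rewrite radial_extZ// radial_ext_unit.
have [[x0 Lx0]|L0] := pselect (exists x, L x); last first.
  have -> : leaf_cone s = set0.
    rewrite E; apply/seteqP; split=> // x [y Ly _]; apply: L0; by exists y.
  exact: connected0.
rewrite E; apply: bigcup_connected.
  by exists x0 => y _; left.
move=> y Ly; apply: connectedU => //; last exact: ray_connected.
by exists y; split=> //; exists 1 => //=; rewrite scale1r.
Qed.

(** This is openness of p at regular points, read off from a curve through x
    on which p grows at unit speed. *)
Lemma radial_ext_open x (W : set 'rV[R]_n) : regular p x ->
  (\forall y \near x, W y) ->
  \forall s \near (0 : R), exists2 y, W y & pt y = pt x + s.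
Proof.
move=> rx Wx; have x0 := regular_neq0 rx.
have dphi : is_derive (0 : R) (1 : R) (fun s : R => pt x + s) 1.
  have := is_deriveD (is_derive_cst (pt x) (0 : R) (1 : R)) (is_derive_id (0 : R) (1 : R)).
  by rewrite add0r.
have [c [c0 dc Hc]] := lift_curve 0 (radial_ext_differentiable hp x0)
  (near_radial_ext_continuous hp x0) (derive_radial_ext_normal hp rx)
  (addr0 (pt x) : (fun s : R => pt x + s) 0 = pt x) dphi.
have Wc : \forall s \near (0 : R), W (c s).
  by apply: (near_comp (is_derive_continuous0 dc)); rewrite c0.
near=> s; exists (c s); first by near: s.
by near: s.
Unshelve. all: by end_near. Qed.

(** E / |y|^2 is a function of p alone.  It is compared along the normal line
    through x and along a curve through x' on which p takes the same values. *)
Lemma normal_derivative_leaf (F : 'rV[R]_n -> R) x x' : minkowski_norm F ->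
  induced_by d M F -> regular p x -> regular p x' -> pt x = pt x' ->
  dot (grad (energy F) x') (nu x') = 0 -> dot (grad (energy F) x) (nu x) = 0.
Proof.
move=> hF iF rx rx' pxx' E'; have x0 := regular_neq0 rx; have x'0 := regular_neq0 rx'.
pose g (s : R) := x + s *: nu x.
have g0 : g 0 = x by rewrite /g scale0r addr0.
have dg : is_derive (0 : R) (1 : R) g (nu x) by exact: is_derive_affine.
have dpg : is_derive (0 : R) (1 : R) (pt \o g) ('D_(nu x) pt x).
  have dp : differentiable pt (g 0) by rewrite g0; exact: (radial_ext_differentiable hp).
  by have := is_derive_comp dg dp; rewrite g0.
have pg0 : (pt \o g) 0 = pt x' by rewrite /= g0.
have [c [c0 dc Hc]] := lift_curve 0 (radial_ext_differentiable hp x'0)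
  (near_radial_ext_continuous hp x'0) (derive_radial_ext_normal hp rx') pg0 dpg.
rewrite add0r derive0 subr0 in dc; set m := (_ / _) in dc.
have dEg : is_derive (0 : R) (1 : R) (energy F \o g) (dot (grad (energy F) x) (nu x)).
  have dE : differentiable (energy F) (g 0) by rewrite g0; exact: energy_differentiable.
  by have := is_derive_comp dg dE; rewrite g0 derive_energy.
have dEc : is_derive (0 : R) (1 : R) (energy F \o c) 0.
  have dE : differentiable (energy F) (c 0) by rewrite c0; exact: energy_differentiable.
  have := is_derive_comp dc dE; rewrite c0 derive_energy//.
  by rewrite (dotZr m (grad (energy F) x') (nu x')) E' mulr0.
have nx : dot (nu x) x = 0 by exact: (unit_normal_radial hp).
have nx' : dot (nu x') x' = 0 by exact: (unit_normal_radial hp).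
have dgg : is_derive (0 : R) (1 : R) (fun s => dot (g s) (g s)) 0.
  have H := is_derive_dot dg dg; apply: is_derive_eq.
  by rewrite g0 [dot x _]dotC nx addr0.
have dcc : is_derive (0 : R) (1 : R) (fun s => dot (c s) (c s)) 0.
  have H := is_derive_dot dc dc; apply: is_derive_eq.
  by rewrite c0 (dotZl m (nu x') x') (dotZr m x' (nu x')) [dot x' _]dotC nx' mulr0 addr0.
have H := is_deriveB (is_deriveM dgg dEc) (is_deriveM dcc dEg).
have cne : \forall s \near (0 : R), c s != 0.
  apply: (near_comp (P := fun y => is_true (y != 0)) (is_derive_continuous0 dc)).
  by rewrite c0; exact: near_punctured.
have gne : \forall s \near (0 : R), g s != 0.
  apply: (near_comp (P := fun y => is_true (y != 0)) (is_derive_continuous0 dg)).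
  by rewrite g0; exact: near_punctured.
have {H} := derive_near0 _ H.
rewrite /= g0 c0 /GRing.scale/= !mulr0 !addr0 add0r => H.
have : dot x' x' * dot (grad (energy F) x) (nu x) = 0.
  apply/eqP; rewrite -oppr_eq0; apply/eqP; rewrite -[RHS]H ?sub0r//.
  near=> s.
  have cs0 : c s != 0 by near: s.
  have gs0 : g s != 0 by near: s.
  have pcs : pt (c s) = pt (g s) by near: s.
  rewrite -[LHS]/(dot (g s) (g s) * energy F (c s) - dot (c s) (c s) * energy F (g s)).
  by rewrite (energy_leaf hp hS hF iF gs0 cs0 (esym pcs)) subrr.
by move/eqP; rewrite mulf_eq0 dot_eq0 (negbTE x'0) => /eqP.
Unshelve. all: by end_near. Qed.

End Leaves.

(** * Gluing *)

(** For u != 0 it vanishes exactly when v is a multiple of u; being polynomial in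
    u and v, it makes collinearity a closed condition. *)
Definition collinearity_defect {R : realType} {n : nat} (u v : 'rV[R]_n) : 'rV[R]_n :=
  dot u u *: v - dot v u *: u.

Lemma collinearity_defect_scale {R : realType} {n : nat} (u : 'rV[R]_n) c :
  collinearity_defect u (c *: u) = 0.
Proof. by rewrite /collinearity_defect dotZl scalerA mulrC subrr. Qed.

Lemma collinearity_defect_eq0 {R : realType} {n : nat} (u v : 'rV[R]_n) :
  u != 0 -> collinearity_defect u v = 0 -> v = (dot v u / dot u u) *: u.
Proof.
move=> u0 /eqP; rewrite subr_eq0 => /eqP E.
have uu : dot u u != 0 by rewrite dot_eq0.
by rewrite mulrC -scalerA -E scalerA mulVf// scale1r.
Qed.

Section Gluing.
Context {R : realType} {n d : nat}.
Context (M : R -> set 'rV[R]_n) (p : 'rV[R]_n -> R).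
Context (hp : isoparametric_polynomial d p).
Context (hS : forall s : R, -1 <= s <= 1 ->
  exists t, param_interval d t /\ M t = level_set p s).
Context (F1 F2 : 'rV[R]_n -> R) (Phi : 'rV[R]_n -> 'rV[R]_n).
Context (hd : (2 < d)%N) (hF1 : minkowski_norm F1) (hF2 : minkowski_norm F2).
Context (i1 : induced_by d M F1) (i2 : induced_by d M F2).
Context (hiso : hessian_isometry F1 F2 Phi).
Context (hPhi : forall x, regular p x -> regular p (Phi x) /\
  exists xi, regular_arc M p (d := d) x xi /\ regular_arc M p (d := d) (Phi x) xi).
Implicit Types (x y z w : 'rV[R]_n).

Local Notation pt := (radial_ext p).
Local Notation nu := (unit_normal p).
Local Notation G1 := (grad (energy F1)).
Local Notation G2 := (grad (energy F2)).

Let key := pointwise_dichotomy hp hS hd hF1 hF2 i1 i2 hiso hPhi.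
Let dPhi := Phi_differentiable hiso.
Let Phi0 := Phi_neq0 hiso.

Lemma grad_energy_neq0 x : x != 0 -> G1 x != 0.
Proof.
move=> x0; apply/eqP => E; have := energy_euler hF1 x0.
by rewrite E dot0l => /esym/eqP; rewrite gt_eqF// mulr_gt0// energy_gt0.
Qed.

Definition defect_id x := collinearity_defect x (Phi x).
Definition defect_legendre x := collinearity_defect (G1 x) (Phi x).

Lemma defect_cases x : regular p x -> defect_id x = 0 \/ defect_legendre x = 0.
Proof.
move=> /key[c [_ [[E _]|[E _]]]]; rewrite /defect_id /defect_legendre E.
  by left; exact: collinearity_defect_scale.
by right; exact: collinearity_defect_scale.
Qed.

Lemma defect_differentiable (u v : 'rV[R]_n -> 'rV[R]_n) x :
  differentiable u x -> differentiable v x ->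
  differentiable (fun y => collinearity_defect (u y) (v y)) x.
Proof.
move=> du dv; apply: differentiableB.
  by apply: differentiable_scale => //; exact: differentiable_dot.
by apply: differentiable_scale => //; exact: differentiable_dot.
Qed.

Lemma open_defect (f : 'rV[R]_n -> 'rV[R]_n) :
  (forall x, x != 0 -> differentiable f x) -> open [set x | x != 0 /\ f x != 0].
Proof.
move=> df; rewrite openE => x [x0 fx0]; apply: filterI; first exact: near_punctured.
apply: (near_comp (differentiable_continuous (df x x0)) (P := fun y => is_true (y != 0))).
exact: near_punctured.
Qed.

Lemma open_defect_id : open [set x | x != 0 /\ defect_id x != 0].
Proof. by apply: open_defect => x x0; apply: defect_differentiable => //; exact: dPhi. Qed.

Lemma open_defect_legendre : open [set x | x != 0 /\ defect_legendre x != 0].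
Proof.
apply: open_defect => x x0; apply: defect_differentiable; last exact: dPhi.
exact: grad_energy_differentiable.
Qed.

(** If dE1 is radial at a point of the leaf, it is radial on the whole leaf, and
    both alternatives of pointwise_dichotomy make Phi radial.  Otherwise the two
    alternatives exclude each other and are both relatively closed in the cone
    over the leaf, which is connected. *)
Lemma defect_id_leaf x x' : regular p x -> regular p x' -> pt x = pt x' ->
  defect_id x = 0 -> defect_id x' = 0.
Proof.
move=> rx rx' pxx' qx.
have regular_leaf y : leaf_cone p (pt x) y -> regular p y.
  by move=> [y0 py]; split=> //; rewrite py; case: rx.
have [D|D] := eqVneq (dot (G1 x') (nu x')) 0.
  have /key[c [_ [[E _]|[E _]]]] := rx'; rewrite /defect_id E.
    exact: collinearity_defect_scale.
  rewrite (in_normal_planeP hp rx' (grad_energy_in_normal_plane hp hS hF1 i1 rx')).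
  by rewrite D scale0r addr0 scalerA; exact: collinearity_defect_scale.
have Dn y : leaf_cone p (pt x) y -> dot (G1 y) (nu y) != 0.
  move=> Ly; apply: contra_neq D => D.
  apply: (normal_derivative_leaf hp hS hF1 i1 rx' (regular_leaf _ Ly) _ D).
  by case: Ly => _ ->.
have one y : leaf_cone p (pt x) y -> defect_id y = 0 -> defect_legendre y != 0.
  move=> Ly qy; have y0 := Ly.1; have Dy := Dn y Ly; apply/eqP => qy'.
  have E1 := collinearity_defect_eq0 (grad_energy_neq0 y0) qy'.
  have E2 := collinearity_defect_eq0 y0 qy.
  have : dot (Phi y) (nu y) = 0.
    by rewrite E2 (dotZl _ y (nu y)) [dot y (nu y)]dotC (unit_normal_radial hp y0) mulr0.
  rewrite {1}E1 (dotZl _ (G1 y) (nu y)) => /eqP.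
  rewrite mulf_eq0 (negbTE Dy) orbF => /eqP c0.
  by have := Phi0 y0; rewrite E1 c0 scale0r eqxx.
have sub : leaf_cone p (pt x) `<=` [set y | y != 0 /\ defect_legendre y != 0].
  apply: (@connected_open_split _ _ _ [set y | y != 0 /\ defect_id y != 0] x).
  - by apply: (leaf_cone_connected hp); case: rx.
  - exact: open_defect_legendre.
  - exact: open_defect_id.
  - move=> y Ly; have [qy|qy] := eqVneq (defect_id y) 0; last by right; split=> //; exact: Ly.1.
    by left; split; [exact: Ly.1|exact: one].
  - move=> y Ly [_ q1] [_ q2].
    by case: (defect_cases (regular_leaf _ Ly)) => E; [rewrite E eqxx in q2|rewrite E eqxx in q1].
  - by split=> //; case: rx.
  - by split; [case: rx|apply: one => //; split=> //; case: rx].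
have [_ q] : x' != 0 /\ defect_legendre x' != 0.
  by apply: sub; split=> //; case: rx'.
by case: (defect_cases rx') => // E; rewrite E eqxx in q.
Qed.

(** The two open pieces.  A leaf on which both alternatives hold is never in the
    second piece. *)
Definition radial_part : set 'rV[R]_n :=
  interior [set x | regular p x /\ defect_id x = 0].
Definition legendre_part : set 'rV[R]_n :=
  [set x | regular p x /\ defect_id x != 0].

Lemma radial_part_sub x : radial_part x -> regular p x /\ defect_id x = 0.
Proof. by move/interior_subset. Qed.

Lemma open_legendre_part : open legendre_part.
Proof.
rewrite openE => x [rx qx]; apply: filterI; first exact: (near_regular hp).
have := open_defect_id; rewrite openE => /(_ x) []; first by split=> //; case: rx.
by move=> e e0 H; exists e => // y /H[].
Qed.

Lemma glued_part_sub x : (radial_part `|` legendre_part) x -> regular p x.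
Proof. by case=> [/radial_part_sub[]|[]]. Qed.

(** In the first piece, leaves close to that of x all meet a neighbourhood of x on
    which Phi is radial, because p is open at x; so Phi is radial on them. *)
Lemma glued_part_saturated x x' : (radial_part `|` legendre_part) x ->
  regular p x' -> pt x = pt x' -> (radial_part `|` legendre_part) x'.
Proof.
move=> [Ox|[rx qx]] rx' pxx'; last first.
  right; split=> //; apply: contra_neq qx => qx'.
  exact: (defect_id_leaf rx' rx).
left; have [rx _] := radial_part_sub Ox.
have Wx : \forall y \near x, regular p y /\ defect_id y = 0 by exact: Ox.
have Ws := radial_ext_open hp rx Wx.
pose f z := pt z - pt x.
have cf : {for x', continuous f}.
  apply: differentiable_continuous; apply: differentiableB => //.
  by apply: (radial_ext_differentiable hp); exact: (regular_neq0 rx').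
have f0 : f x' = 0 by rewrite /f pxx' subrr.
rewrite -f0 in Ws.
have rn := near_regular hp rx'.
have Wn := near_comp cf Ws.
rewrite /radial_part /interior /=.
apply: filterS2 rn Wn => z rz [y [ry qy] pyz]; split=> //.
by apply: (defect_id_leaf ry rz _ qy); rewrite pyz /f addrC subrK.
Qed.

Lemma energy_Phi y : regular p y -> energy F2 (Phi y) = energy F1 y.
Proof.
move=> ry; have y0 := regular_neq0 ry.
apply: (@mulfI _ 2); first by rewrite pnatr_eq0.
rewrite -(energy_euler hF2 (Phi0 y0)) -(energy_euler hF1 y0).
have [c [c0 [[-> ->]|[-> ->]]]] := key ry; rewrite dotZl dotZr mulKf ?lt0r_neq0//.
exact: dotC.
Qed.

(** Differentiate E2 o Phi = E1. *)
Lemma dot_legendre_dPhi z v : regular p z ->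
  dot (G2 (Phi z)) ('D_v Phi z) = dot (G1 z) v.
Proof.
move=> rz; have z0 := regular_neq0 rz.
rewrite -(derive_energy hF2 _ (Phi0 z0)) -(derive_energy hF1 _ z0).
have dP := derivableP (v := v) (diff_derivable (dPhi z0)).
have [_ <-] := is_derive_comp dP (energy_differentiable hF2 (Phi0 z0)).
by apply: near_eq_derive; apply: filterS (near_regular hp rz) => y; exact: energy_Phi.
Qed.

Lemma radial_factor z : regular p z -> defect_id z = 0 ->
  let k := dot (Phi z) z / dot z z in
  [/\ 0 < k, Phi z = k *: z & G2 (Phi z) = k^-1 *: G1 z].
Proof.
move=> rz qz k; have z0 := regular_neq0 rz.
have E : Phi z = k *: z by exact: collinearity_defect_eq0.
have zz : 0 < dot z z by rewrite dot_gt0.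
have [c [c0 [[Pc Gc]|[Pc Gc]]]] := key rz.
  have kc : k = c by rewrite /k Pc dotZl mulfK// lt0r_neq0.
  by rewrite kc.
(* Here dE1(z) is radial too, and the second alternative turns into the first. *)
have k0 : 0 < k.
  rewrite /k Pc dotZl (energy_euler hF1 z0) divr_gt0// mulr_gt0// mulr_gt0//.
  exact: (energy_gt0 hF1).
split=> //; rewrite Gc.
apply: (@scalerI _ _ (c * k)); first by rewrite mulf_neq0// lt0r_neq0.
rewrite !scalerA mulrAC divff ?mul1r ?lt0r_neq0// -mulrA divff ?mulr1 ?lt0r_neq0//.
by rewrite -E.
Qed.

Lemma legendre_factor z : regular p z -> defect_id z != 0 ->
  let k := dot (Phi z) (G1 z) / dot (G1 z) (G1 z) in
  [/\ 0 < k, Phi z = k *: G1 z & G2 (Phi z) = k^-1 *: z].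
Proof.
move=> rz qz k; have z0 := regular_neq0 rz.
have zz : 0 < dot (G1 z) (G1 z) by rewrite dot_gt0 grad_energy_neq0.
have [c [c0 [[Pc Gc]|[Pc Gc]]]] := key rz.
  by move: qz; rewrite /defect_id Pc collinearity_defect_scale eqxx.
have kc : k = c by rewrite /k Pc dotZl mulfK// lt0r_neq0.
by rewrite kc.
Qed.

(** By the last hypothesis, f D_v u already accounts for the derivative of
    E2 o Phi = E1 in the direction v, so that the remaining term
    D_v f <dE2(Phi z), u z> is 0. *)
Lemma derive_factor_eq0 (u : 'rV[R]_n -> 'rV[R]_n) (f : 'rV[R]_n -> R) z v :
  regular p z -> differentiable u z -> differentiable f z ->
  (\forall y \near z, Phi y = f y *: u y) ->
  dot (G2 (Phi z)) (u z) != 0 ->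
  f z * dot (G2 (Phi z)) ('D_v u z) = dot (G1 z) v ->
  is_derive z v f 0.
Proof.
move=> rz du df Pf gu H.
have dfv := derivableP (v := v) (diff_derivable df).
have duv := derivableP (v := v) (diff_derivable du).
have [_ E] := is_derive_scale dfv duv.
have := dot_legendre_dPhi v rz; rewrite (near_eq_derive _ Pf) E.
rewrite dotDr dotZr (dotZr (f z)) H -[RHS]add0r => /addIr/eqP.
by rewrite mulf_eq0 (negbTE gu) orbF => /eqP D; rewrite -D.
Qed.

Lemma radial_part_constant (C : set 'rV[R]_n) x : connected C ->
  C `<=` radial_part -> C x -> exists c : R, 0 < c /\ forall y, C y -> Phi y = c *: y.
Proof.
move=> cC CO Cx; pose f z := dot (Phi z) z / dot z z.
have rx := radial_part_sub (CO _ Cx).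
exists (f x); split; first by case: (radial_factor rx.1 rx.2).
move=> y Cy; have [ry qy] := radial_part_sub (CO _ Cy).
rewrite (_ : f x = f y); first by case: (radial_factor ry qy).
apply: (locally_constant_connected _ _ cC CO Cx Cy); first exact: open_interior.
move=> z Oz v; have [rz qz] := radial_part_sub Oz; have z0 := regular_neq0 rz.
have [k0 Pz Gz] := radial_factor rz qz.
have df : differentiable f z.
  apply: differentiableM; first by apply: differentiable_dot => //; exact: dPhi.
  by apply: differentiableV; [exact: differentiable_dot|rewrite dot_eq0].
have nearP : \forall y \near z, Phi y = f y *: id y.
  apply: filterS (Oz : nbhs z _) => w [rw qw].
  by case: (radial_factor rw qw).
apply: (derive_factor_eq0 rz _ df nearP) => //.
- rewrite Gz dotZl (energy_euler hF1 z0) mulf_neq0 ?invr_eq0 ?lt0r_neq0// mulr_gt0//.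
  exact: (energy_gt0 hF1).
- by rewrite derive_id Gz dotZl mulVKf// lt0r_neq0.
Qed.

Lemma legendre_part_constant (C : set 'rV[R]_n) x : connected C ->
  C `<=` legendre_part -> C x ->
  exists c : R, 0 < c /\ forall y, C y -> Phi y = c *: legendre F1 y.
Proof.
move=> cC CO Cx; pose f z := dot (Phi z) (G1 z) / dot (G1 z) (G1 z).
have rx := CO _ Cx.
exists (f x); split; first by case: (legendre_factor rx.1 rx.2).
move=> y Cy; have [ry qy] := CO _ Cy.
rewrite (_ : f x = f y); first by case: (legendre_factor ry qy).
apply: (locally_constant_connected open_legendre_part _ cC CO Cx Cy).
move=> z Oz v; have [rz qz] := Oz; have z0 := regular_neq0 rz.
have [k0 Pz Gz] := legendre_factor rz qz.
have dG := grad_energy_differentiable hF1 z0.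
have df : differentiable f z.
  apply: differentiableM; first by apply: differentiable_dot => //; exact: dPhi.
  apply: differentiableV; first exact: differentiable_dot.
  by rewrite dot_eq0 grad_energy_neq0.
have nearP : \forall y \near z, Phi y = f y *: G1 y.
  have := open_legendre_part; rewrite openE => /(_ _ Oz).
  by apply: filterS => w [rw qw]; case: (legendre_factor rw qw).
apply: (derive_factor_eq0 rz dG df nearP) => //.
- rewrite Gz dotZl [dot z (G1 z)]dotC (energy_euler hF1 z0) mulf_neq0 ?invr_eq0 ?lt0r_neq0// mulr_gt0//.
  exact: (energy_gt0 hF1).
- rewrite Gz dotZl mulVKf ?lt0r_neq0// [dot z _]dotC.
  exact: derive_grad_energy_radial.
Qed.

Lemma glued_component x : (radial_part `|` legendre_part) x ->
  let K := connected_component (radial_part `|` legendre_part) x in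
  (exists c : R, 0 < c /\ forall y, K y -> Phi y = c *: y) \/
  (exists c : R, 0 < c /\ forall y, K y -> Phi y = c *: legendre F1 y).
Proof.
move=> Ox K.
have cK : connected K by exact: component_connected.
have KO : K `<=` radial_part `|` legendre_part by exact: connected_component_sub.
have Kx : K x by exact: connected_component_refl.
have oA : open radial_part by exact: open_interior.
have dis y : K y -> radial_part y -> legendre_part y -> False.
  by move=> _ /radial_part_sub[_ qy] [_]; rewrite qy eqxx.
case: (Ox) => [Ax|Bx].
  left; apply: (radial_part_constant cK _ Kx).
  exact: (connected_open_split cK oA open_legendre_part KO dis Kx Ax).
right; apply: (legendre_part_constant cK _ Kx).
apply: (connected_open_split cK open_legendre_part oA _ _ Kx Bx).
  by rewrite setUC.
by move=> y Ky By Ay; exact: dis Ay By.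
Qed.

Lemma glued_part_open : open (radial_part `|` legendre_part).
Proof. by apply: openU; [exact: open_interior|exact: open_legendre_part]. Qed.

Lemma glued_part_dense : (1 < n)%N ->
  punctured `<=` closure (radial_part `|` legendre_part).
Proof.
move=> n1 x x0 B Bx.
have d0 : (0 < d)%N by exact: ltn_trans hd.
have [y [ry By]] : (regular p `&` interior B) !=set0.
  apply: (regular_dense n1 d0 hp x0); exact: nbhs_interior.
have [[z [[rz Bz] qz]]|H] := pselect (exists z, (regular p z /\ B z) /\ defect_id z != 0).
  by exists z; split=> //; right.
exists y; split; last exact: interior_subset By.
left; rewrite /radial_part /interior /=.
apply: filterS2 (near_regular hp ry) (By : nbhs y B) => z rz Bz; split=> //.
by apply/eqP/contraT => qz; exfalso; apply: H; exists z.
Qed.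

(** Both descriptions of Phi say that the symmetric products of x with dE1(x)
    and of Phi(x) with dE2(Phi(x)) agree; this identity extends by density. *)
Lemma symmetric_product (n1 : (1 < n)%N) x i j : x != 0 ->
  x 0 i * G1 x 0 j + x 0 j * G1 x 0 i =
  Phi x 0 i * G2 (Phi x) 0 j + Phi x 0 j * G2 (Phi x) 0 i.
Proof.
move=> x0.
pose f y := (y 0 i * G1 y 0 j + y 0 j * G1 y 0 i) -
  (Phi y 0 i * G2 (Phi y) 0 j + Phi y 0 j * G2 (Phi y) 0 i).
suff : f x = 0 by move/eqP; rewrite subr_eq0 => /eqP.
have dG1 := grad_energy_differentiable hF1 x0.
have dK : differentiable (G2 \o Phi) x.
  apply: differentiable_comp; first exact: dPhi.
  by apply: grad_energy_differentiable => //; exact: Phi0.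
have cf : {for x, continuous f}.
  apply: differentiable_continuous; apply: differentiableB; apply: differentiableD;
    apply: differentiableM.
  - exact: (@differentiable_coordT _ _ _ id).
  - exact: (@differentiable_coordT _ _ _ G1).
  - exact: (@differentiable_coordT _ _ _ id).
  - exact: (@differentiable_coordT _ _ _ G1).
  - by apply: (@differentiable_coordT _ _ _ Phi); exact: dPhi.
  - exact: (@differentiable_coordT _ _ _ (G2 \o Phi)).
  - by apply: (@differentiable_coordT _ _ _ Phi); exact: dPhi.
  - exact: (@differentiable_coordT _ _ _ (G2 \o Phi)).
have d0 : (0 < d)%N by exact: ltn_trans hd.
apply/eqP/contraT => fx0.
have Nf : \forall y \near x, f y != 0.
  apply: (near_comp (P := fun r : R => is_true (r != 0)) cf).
  by have := @open_neq R 0; rewrite openE; exact.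
have [y [ry /eqP]] := regular_dense n1 d0 hp x0 Nf.
case; have [c [c0 [[Pc Gc]|[Pc Gc]]]] := key ry;
  rewrite /f Gc Pc !mxE; field; exact: lt0r_neq0.
Qed.

(** By Euler's identity both sides of the (d)-property are values of the
    differentials dE1 and dE2.  With the self-adjoint projection pr to V'' they are
    half the pairings of pr with the two symmetric products. *)
Lemma hessian_isometry_d_property (n1 : (1 < n)%N) (V' V'' : {vspace 'rV[R]_n}) :
  orthogonal_decomposition V' V'' -> d_property F1 F2 Phi V' V''.
Proof.
move=> [VV orth] x x' x'' y' y'' x0 xE yE Vx' Vy' Vx'' Vy''.
have capV : (V'' :&: V' = 0)%VS.
  apply/eqP; rewrite -subv0; apply/subvP => v; rewrite memv_cap memv0 => /andP[v2 v1].
  by rewrite -dot_eq0 (orth _ _ v1 v2).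
pose pr : 'End('rV[R]_n) := daddv_pi V'' V'.
have pr2 v : v \in V'' -> pr v = v by exact: daddv_pi_id.
have pr1 v : v \in V' -> pr v = 0.
  move=> v1; have v12 : v \in (V'' + V')%VS by rewrite addvC VV memvf.
  have := daddv_pi_add capV v12; rewrite (@daddv_pi_id _ _ V' V'') 1?capvC//.
  by move/eqP; rewrite -subr_eq0 addrK => /eqP.
have prD v1 v2 : v1 \in V' -> v2 \in V'' -> pr (v1 + v2) = v2.
  by move=> h1 h2; rewrite linearD /= pr1// pr2// add0r.
have dec v : exists v1 v2, [/\ v1 \in V', v2 \in V'' & v = v1 + v2].
  have /memv_addP[v1 h1 [v2 h2 ->]] : v \in (V' + V'')%VS by rewrite VV memvf.
  by exists v1, v2.
have sym a b : dot a (pr b) = dot (pr a) b.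
  have [a1 [a2 [ha1 ha2 ->]]] := dec a; have [b1 [b2 [hb1 hb2 ->]]] := dec b.
  rewrite !prD// dotDl dotDr (orth a1 b2)// add0r [dot a2 b1]dotC (orth b1 a2)//.
  by rewrite add0r.
pose A := lin1_mx pr.
have prA v i : pr v 0 i = \sum_j v 0 j * A j i.
  by rewrite -[pr v]mul_rV_lin1 mxE.
have bil a b : dot (pr a) b = \sum_i \sum_j A j i * (a 0 j * b 0 i).
  rewrite dotE; apply: eq_bigr => i _; rewrite prA big_distrl/=.
  by apply: eq_bigr => j _; rewrite mulrAC mulrC.
have H : dot (pr x) (G1 x) + dot (pr (G1 x)) x =
    dot (pr (Phi x)) (G2 (Phi x)) + dot (pr (G2 (Phi x))) (Phi x).
  rewrite !bil -!big_split/=; apply: eq_bigr => i _.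
  rewrite -!big_split/=; apply: eq_bigr => j _.
  rewrite -!mulrDr; congr (_ * _).
  have := symmetric_product n1 i j x0.
  rewrite [x 0 j * _ + _]addrC [Phi x 0 j * _ + _]addrC.
  by rewrite [G1 x 0 j * _]mulrC [G2 _ 0 j * _]mulrC.
rewrite hessian_metricE// (derive_grad_energy_radial hF1)//.
rewrite hessian_metricE ?Phi0// (derive_grad_energy_radial hF2) ?Phi0//.
have Ex : pr x = x'' by rewrite xE prD.
have Ey : pr (Phi x) = y'' by rewrite yE prD.
have tw a b : dot (pr b) a = dot (pr a) b by rewrite -sym dotC.
move: H; rewrite (tw x) (tw (Phi x)) Ex Ey [dot x'' _]dotC [dot y'' _]dotC; lra.
Qed.

End Gluing.

(** * The gluing theorem *)

Theorem theoremE (R : realType) (n d : nat) (M : R -> set 'rV[R]_n)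
    (F1 F2 : 'rV[R]_n -> R) (Phi : 'rV[R]_n -> 'rV[R]_n) :
  (2 < n)%N -> (2 < d)%N ->
  isoparametric_foliation d M ->
  minkowski_norm F1 -> minkowski_norm F2 ->
  induced_by d M F1 -> induced_by d M F2 ->
  hessian_isometry F1 F2 Phi ->
  preserves_orientation Phi ->
  fixes_xi d M Phi ->
  (exists (T : set R) (U : set 'rV[R]_n),
    [/\ T `<=` [set t | 0 < t < pi / d%:R],
        U = \bigcup_(t in T) M t,
        open (positive_cone U),
        punctured `<=` closure (positive_cone U) &
        forall x, positive_cone U x ->
          let K := connected_component (positive_cone U) x in
          (exists c : R, 0 < c /\ forall y, K y -> Phi y = c *: y) \/
          (exists c : R, 0 < c /\ forall y, K y -> Phi y = c *: legendre F1 y)])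
  /\
  (forall V' V'' : {vspace 'rV[R]_n},
    orthogonal_decomposition V' V'' -> d_property F1 F2 Phi V' V'').
Proof.
move=> n2 d2 fol hF1 hF2 i1 i2 hiso _ [_ hfix].
have [p [hp hM hS h01]] := isofol_levels fol.
have regE := regular_pointsE hp h01.
have arc x r t xi : spherical_coords d M x r t xi -> regular_arc M p (d := d) x xi.
  move=> [_ _ _ _ [g [a [b [ng ab ga gb nf]]]]]; exists g, a, b; split=> // s sab.
  have [us _ _] := ng.1.2 s.
  by apply/(regular_unit hp h01 us); exact: nf.
have hPhi x : regular p x -> regular p (Phi x) /\
    exists xi, regular_arc M p (d := d) x xi /\ regular_arc M p (d := d) (Phi x) xi.
  move=> /regE /hfix[xi [r [t [r' [t' [sx sPx]]]]]]; split.
    by apply/regE; case: sPx.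
  by exists xi; split; [exact: arc sx|exact: arc sPx].
have n1 : (1 < n)%N by exact: ltnW.
split; last first.
  move=> V' V''.
  exact: (hessian_isometry_d_property hp hS d2 hF1 hF2 i1 i2 hiso hPhi n1).
pose O := radial_part p Phi `|` legendre_part p Phi.
pose T := [set t | param_interval d t /\ exists2 x, O x & M t (normalize x)].
have leafE t x : T t -> M t x -> exists s, M t = level_set p s /\ p x = s /\ enorm x = 1.
  by move=> [/hM[s [_ Ms]] _]; rewrite Ms => -[x1 px]; exists s.
have OE : positive_cone (\bigcup_(t in T) M t) = O.
  apply/seteqP; split=> [x [l [u [l0 [t Tt Mu] ->]]]|x Ox].
    have [s [Ms [pu u1]]] := leafE t u Tt Mu.
    have [_ [y Oy]] := Tt; rewrite Ms => -[y1 py].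
    have pyu : radial_ext p y = radial_ext p (l *: u).
      by rewrite radial_extZ// (radial_ext_unit p u1) pu -py.
    apply: (glued_part_saturated hp hS d2 hF1 hF2 i1 i2 hiso hPhi Oy _ pyu).
    split; first by rewrite scaler_eq0 negb_or gt_eqF//= unit_neq0.
    by rewrite -pyu; case: (glued_part_sub Oy).
  have [x0 _] := glued_part_sub Ox.
  have [t [ht Mt]] := hS _ (radial_ext_range hp x0).
  have Mx : M t (normalize x) by rewrite Mt; split=> //; exact: enorm_normalize.
  exists (enorm x), (normalize x); split.
  - by rewrite enorm_gt0.
  - by exists t => //; split=> //; exists x.
  - by rewrite scale_normalize.
exists T, (\bigcup_(t in T) M t); rewrite OE; split=> //.
- move=> t [/andP[t0 t1] [x Ox Mx]] /=.
  have [x0 /andP[px1 px2]] := glued_part_sub Ox.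
  have nfoc : ~ focal d M (normalize x).
    apply/(regular_unit hp h01 (enorm_normalize x0)).
    by apply: regular_normalize; exact: (glued_part_sub Ox).
  apply/andP; split; rewrite lt_neqAle ?t0 ?t1 andbT; apply/eqP => E; apply: nfoc.
    by left; rewrite E.
  by right; rewrite -E.
- exact: (glued_part_open hp hiso).
- exact: (glued_part_dense hp Phi d2 n1).
- move=> x Ox; exact: (glued_component hp hS d2 hF1 hF2 i1 i2 hiso hPhi Ox).
Qed.
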